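(* Let $\mathcal{K}$ be a local field, and let $\xi = (\xi_i)_{i \in \mathbb{N}}$ be an infinite sequence of $\mathcal{K}$-valued random variables defined on a probability space $(\Omega, \mathcal{F}, \mathbb{P})$. Then $\xi$ is rotatable if and only if $\sup_{i \in \mathbb{N}} |\xi_i|$ is almost surely finite and, possibly on some extension of $(\Omega, \mathcal{F}, \mathbb{P})$, one has $\xi_i = \tau \eta_i$ almost surely for all $i \in \mathbb{N}$, where (a) $\eta_1, \eta_2, \dots$ are independent, identically distributed, standard $\mathcal{K}$-Gaussian random variables; (b) $\tau$ is the random variable taking values in $\{\rho^m : m \in \mathbb{Z}\} \cup \{0\}$ given (on the almost sure event that $\sup_j |\xi_j|$ is finite) by \[ \tau := \begin{cases} \rho^m, & \sup_j |\xi_j| = q^{-m}, \; m \in \mathbb{Z}, \\ 0, & \sup_j |\xi_j| = 0; \end{cases} \] (c) the random variable $\tau$ is independent of the sequence $\eta = (\eta_i)_{i \in \mathbb{N}}$.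
   Context: $\mathbb{N} = \{1,2,\dots\}$ and $[n] = \{1,\dots,n\}$. A local field $\mathcal{K}$ is a locally compact, non-discrete topological field other than $\mathbb{R}$ or $\mathbb{C}$ (equivalently, for some prime $p$, a finite algebraic extension of the field of $p$-adic numbers or of the field of Laurent series over the finite field with $p$ elements). It carries its normalized non-Archimedean valuation $|\cdot|$, which satisfies $|x| = 0 \iff x = 0$, $|xy| = |x||y|$, $|x+y| \le |x| \vee |y|$, induces the topology of $\mathcal{K}$, and takes exactly the values $\{0\} \cup \{q^m : m \in \mathbb{Z}\}$, where $q = p^c$ for some prime $p$ and positive integer $c$. Let $\mathcal{D} = \{x \in \mathcal{K} : |x| \le 1\}$ be the ring of integers. Fix $\rho \in \mathcal{K}$ with $|\rho| = q^{-1}$; the valuation is normalized so that $\mathcal{D}/\rho\mathcal{D}$ has $q$ elements. $\mathrm{GL}_n(\mathcal{D})$ is the group of $n \times n$ matrices $U$ with entries in $\mathcal{D}$ and $|\det U| = 1$ (equivalently, the matrices that are isometries of $\mathcal{K}^n$ for the norm $\|x\| = \bigvee_{i \in [n]} |x_i|$). An infinite sequence $(\xi_i)_{i\in\mathbb{N}}$ of $\mathcal{K}$-valued random variables is rotatable if $U(\xi_i)_{i \in [n]}$ has the same distribution as $(\xi_i)_{i \in [n]}$ for every $n \in \mathbb{N}$ and every $U \in \mathrm{GL}_n(\mathcal{D})$. A $\mathcal{K}$-valued random variable is standard $\mathcal{K}$-Gaussian if its distribution is $\gamma$, the restriction to $\mathcal{D}$ of the additive Haar measure $\lambda$ on $\mathcal{K}$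 normalized by $\lambda(\mathcal{D}) = 1$ (so $\gamma$ is a probability measure). An extension of $(\Omega,\mathcal{F},\mathbb{P})$ is a probability space $(\bar\Omega,\bar{\mathcal{F}},\bar{\mathbb{P}})$ with a measurable map to $\Omega$ pushing $\bar{\mathbb{P}}$ forward to $\mathbb{P}$; random variables on $\Omega$ are regarded as random variables on $\bar\Omega$ by composition with this map. *)

(* Defs.v *)
From HB Require Import structures.
From mathcomp Require Import all_boot all_order all_algebra finmap.
From mathcomp Require Import all_classical all_reals all_analysis.

Set Implicit Arguments.
Unset Strict Implicit.
Unset Printing Implicit Defensive.

Import Order.TTheory GRing.Theory Num.Theory.

Local Open Scope classical_set_scope.
Local Open Scope card_scope.
Local Open Scope ring_scope.

HB.mixin Record isTopologicalField K & GRing.Field K & Topological K := {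
  fmul_continuous : continuous (fun x : K * K => x.1 * x.2) ;
  finv_continuous : forall x : K, x != 0 -> {for x, continuous (@GRing.inv K)}
}.

#[short(type="topologicalFieldType")]
HB.structure Definition TopologicalField :=
  {K of GRing.Field K & TopologicalZmodule K & isTopologicalField K}.

Section LocalFields.
Context {R : realType} {K : topologicalFieldType}.
Implicit Types (v : K -> R) (q : nat).

Definition ring_of_integers v : set K := [set x | v x <= 1].

(* [v] is the normalized non-Archimedean valuation of [K]. *)
Record normalized_valuation v q : Prop := NormalizedValuation {
  nv_prime_power :
    exists p c : nat, [/\ prime p, (0 < c)%N & q = (p ^ c)%N] ;
  nv_eq0 : forall x, v x = 0 <-> x = 0 ;
  nv_mul : forall x y, v (x * y) = v x * v y ;
  nv_add : forall x y, v (x + y) <= Num.max (v x) (v y) ;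
  nv_range : range v = [set 0] `|` range (fun m : int => q%:R ^ m) ;
  nv_nbhs : forall (x : K) (A : set K),
    nbhs x A <-> exists2 e : R, 0 < e & [set y | v (y - x) < e] `<=` A ;
  (* D / rho D, as a set of cosets, has q elements *)
  nv_residue : forall rho, v rho = q%:R^-1 ->
    [set [set x + rho * y | y in ring_of_integers v]
       | x in ring_of_integers v] #= `I_q
}.

(* [K] is locally compact and non-discrete. The fields of real and complex
   numbers are excluded because the topology of [K] is induced by the
   ultrametric valuation [v]. *)
Record local_field v q : Prop := LocalField {
  lf_locally_compact : locally_compact [set: K] ;
  lf_nondiscrete : ~ (forall A : set K, open A) ;
  lf_valuation : normalized_valuation v q
}.

Definition GL_integers v (n : nat) (U : 'M[K]_n) : Prop :=
  (forall i j, ring_of_integers v (U i j)) /\ v (\det U) = 1.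

End LocalFields.

(* Measurable types are required to be pointed; the base point is 0. *)
Definition pointed_at_0 (K : topologicalFieldType) : Type := K.

HB.instance Definition _ (K : topologicalFieldType) :=
  Choice.on (pointed_at_0 K).
HB.instance Definition _ (K : topologicalFieldType) :=
  isPointed.Build (pointed_at_0 K) (0 : K).

Definition borel (K : topologicalFieldType) :=
  @g_sigma_algebraType (pointed_at_0 K) (@open K).

HB.instance Definition _ (K : topologicalFieldType) :=
  Measurable.on (borel K).

(* The product sigma-algebra on [I -> T], generated by the coordinates. *)
Definition cylinders (I : Type) d (T : measurableType d) :
    set (set (I -> T)) :=
  \bigcup_i preimage_set_system setT (fun x : I -> T => x i) measurable.

Definition prod_space (I : Type) d (T : measurableType d) :=
  g_sigma_algebraType (@cylinders I d T).

HB.instance Definition _ (I : Type) d (T : measurableType d) :=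
  Measurable.on (prod_space I T).

Section Haar.
Context {R : realType} {K : topologicalFieldType}.

Record haar_measure (lambda : {measure set (borel K) -> \bar R}) : Prop :=
  HaarMeasure {
    haar_translation : forall (x : K) (A : set (borel K)), measurable A ->
      lambda [set x + a | a in (A : set K)] = lambda A ;
    haar_compact : forall C : set K, compact C -> (lambda C < +oo)%E ;
    haar_open : forall U : set K, open U -> U !=set0 -> (0 < lambda U)%E
  }.

Definition gamma (v : K -> R) (lambda : {measure set (borel K) -> \bar R})
  (A : set (borel K)) : \bar R := lambda (A `&` ring_of_integers v).

End Haar.

Section Laws.
Context d (Omega : measurableType d) (R : realType) (P : probability Omega R).

Definition has_law d' (T : measurableType d') (X : Omega -> T)
    (mu : set T -> \bar R) : Prop :=
  forall A : set T, measurable A -> pushforward P X A = mu A.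

Definition independent d1 (T1 : measurableType d1) d2 (T2 : measurableType d2)
    (X : Omega -> T1) (Y : Omega -> T2) : Prop :=
  forall (A : set T1) (B : set T2), measurable A -> measurable B ->
    P (X @^-1` A `&` Y @^-1` B) = (P (X @^-1` A) * P (Y @^-1` B))%E.

Definition mutually_independent (I : choiceType) d' (T : measurableType d')
    (X : I -> Omega -> T) : Prop :=
  forall (J : {fset I}) (A : I -> set T), (forall i, measurable (A i)) ->
    P (\bigcap_(i in [set` J]) (X i @^-1` A i)) =
    (\prod_(i <- J) P (X i @^-1` A i))%E.

End Laws.

Definition extension d (Omega : measurableType d) (R : realType)
    (P : probability Omega R) d' (Omega' : measurableType d')
    (P' : probability Omega' R) (pi : {mfun Omega' >-> Omega}) : Prop :=
  has_law P' pi P.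

(* Sequences are indexed from 0. *)
Section Sequences.
Context d (Omega : measurableType d) (R : realType) (P : probability Omega R).
Context (K : topologicalFieldType).
Implicit Types (v : K -> R) (xi : nat -> Omega -> borel K).

Definition rotatable v xi : Prop :=
  forall n : nat, (0 < n)%N -> forall U : 'M[K]_n, GL_integers v U ->
    has_law P
      ((fun w i => (U *m \col_(j < n) (xi j w : K)) i 0)
         : Omega -> prod_space 'I_n (borel K))
      (pushforward P
        ((fun w i => xi i w) : Omega -> prod_space 'I_n (borel K))).

Definition sup_val v xi (w : Omega) : \bar R :=
  ereal_sup (range (fun i => (v (xi i w))%:E)).

(* The last branch covers a zero supremum, and gives the value 0 when the
   supremum is infinite. *)
Definition tau v (rho : K) (q : nat) xi (w : Omega) : borel K :=
  match pselect (exists m : int, sup_val v xi w = (q%:R ^ (- m))%:E) with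
  | left h => rho ^ projT1 (cid h)
  | right _ => 0 : K
  end.

Definition iid_standard_gaussian v
    (lambda : {measure set (borel K) -> \bar R}) xi : Prop :=
  mutually_independent P xi /\ forall i, has_law P (xi i) (gamma v lambda).

End Sequences.

(* Main.v *)
Require Import Defs.
From HB Require Import structures.
From mathcomp Require Import all_boot all_order all_algebra finmap.
From mathcomp Require Import all_classical all_reals all_analysis.
From mathcomp Require Import ring zify.

Set Implicit Arguments.
Unset Strict Implicit.
Unset Printing Implicit Defensive.

Import Order.TTheory GRing.Theory Num.Theory.

Local Open Scope classical_set_scope.
Local Open Scope ring_scope.

(**
Throughout, q is the residue cardinality and a ball of level k has radius
q ^ (- k); balls of equal level are the cosets of rho ^ k D.

From right to left, conditioning on the value t of tau reduces the claim to the
invariance of the law of n independent Gaussians under a matrix U of GL_n(D)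
([gaussian_rotation]). Such a U is an isometry, so it permutes the polyballs of
any given level; all polyballs of level l inside D ^ n have the same mass
q ^ (- n l), those outside have mass 0, and polyballs form a pi-system that
generates the Borel sets.

From left to right, only the shears x_i := x_i + c x_j with c in D are needed.
Suppose that |x_j| = q ^ (- m). Letting c vary, the shears translate x_i by every
element of rho ^ m D and leave the other coordinates alone. So, given the other
coordinates and given |x_i| <= q ^ (- m), the coordinate x_i is uniform on
rho ^ m D, in other words x_i / rho ^ m is Gaussian ([tail_uniform],
[tail_gaussian]). Three consequences follow.
- Given that |x_j| = q ^ (- m), each further coordinate is less than q ^ (- m) in
  absolute value with conditional probability at most 1/q; hence almost surely
  the coordinates do not all become smaller than q ^ (- m) from some index on
  ([late_small_null]).
- If the sequence is unbounded, then |x_0| is, with conditional probability at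
  most 1/q, smaller than any given bound; letting the bound grow, the
  sequence is almost surely bounded ([unbounded_null]).
- On the event sup |x_j| = q ^ (- m), the supremum is reached beyond index n, and
  the first n coordinates can be treated one at a time; so x / rho ^ m is a
  sequence of independent Gaussians, conditionally on each positive value of the
  supremum ([scaled_coordinates_gaussian]).

Where tau vanishes, xi carries no information and the Gaussian sequence has to
come from an extension: the product of Omega with D under Haar measure. A single
Haar-distributed element of D yields an infinite independent Gaussian sequence,
because separating its digits of even and of odd rank maps the Haar measure of D
to the product of two copies of itself ([interleaving_independent],
[gaussian_sequence]).
*)

(** * Measure-theoretic preliminaries *)

Lemma pmuleI (R : realType) (c : R) : 0 < c -> injective (fun x => c%:E * x)%E.
Proof.
move=> c0 x y /= xy; rewrite -(mul1e x) -(mul1e y) -(mulVf (lt0r_neq0 c0)).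
by rewrite EFinM -!muleA xy.
Qed.

Lemma ge0_sume_const (R : realType) (I : finType) (x : \bar R) : (0 <= x)%E ->
  (\sum_(i in I) x = #|I|%:R%:E * x)%E.
Proof.
move=> x0; rewrite big_const; elim: #|I| => [|n IH]; first by rewrite mul0e.
by rewrite iterS IH -{1}(mul1e x) -ge0_muleDl ?lee_fin// -EFinD -natr1 addrC.
Qed.

Lemma prode_eq0 (R : realType) n (f : 'I_n -> \bar R) k : f k = 0%E -> (\prod_(i < n) f i)%E = 0%E.
Proof. by move=> fk; rewrite (bigD1 k)//= fk mul0e. Qed.

(** Packages the trace of a measure on B, transported by f, so that uniqueness
    theorems for measures apply to probabilities of the form mu (B /\ f in A). *)
Lemma image_restriction_measure (R : realType) d (T : measurableType d)
    d' (T' : measurableType d') (mu : {measure set T -> \bar R}) (B : set T)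
    (f : T -> T') : measurable B -> measurable_fun setT f ->
  exists nu : {measure set T' -> \bar R}, forall A, nu A = mu (B `&` f @^-1` A).
Proof.
move=> mB mf; pose m : {measure set T -> \bar R} := mrestr mu mB.
exists (pushforward m f) => A; by rewrite /= /pushforward /m/= /mrestr setIC.
Unshelve. exact: mf.
Qed.

Lemma measure_ae_eq (R : realType) d (T : measurableType d)
    (mu : {measure set T -> \bar R}) (A B : set T) : measurable A -> measurable B ->
  {ae mu, forall w, A w <-> B w} -> mu A = mu B.
Proof.
move=> mA mB [N [mN N0 HN]].
have le (C D : set T) : measurable C -> measurable D ->
    C `<=` D `|` N -> (mu C <= mu D)%E.
  move=> mC mD CD; apply: (@le_trans _ _ (mu (D `|` N))).
    by apply: le_measure; rewrite ?inE//; exact: measurableU.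
  by rewrite measureU0.
apply/eqP; rewrite eq_le; apply/andP; split; apply: le => // w Cw;
  (have [Nw|nNw] := pselect (N w); [by right|left]);
  have ABw : A w <-> B w by apply: contrapT => H; apply: nNw; exact: HN.
- exact/ABw.
- exact/ABw.
Qed.

(** Keeping A indexed by all of nat lets n vary without changing types. *)
Definition box_event T U (X : nat -> T -> U) (n : nat) (A : nat -> set U) : set T :=
  [set w | forall i, (i < n)%N -> A i (X i w)].

Lemma measurable_box_event d (T : measurableType d) d' (U : measurableType d')
    (X : nat -> T -> U) n A :
  (forall i, measurable_fun setT (X i)) -> (forall i, measurable (A i)) ->
  measurable (box_event X n A).
Proof.
move=> mX mA; rewrite (_ : box_event X n A = \bigcap_(i in `I_n) (X i @^-1` A i)).
  by apply: fin_bigcap_measurable => // i _; rewrite -[X in measurable X]setTI; exact: mX.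
by apply/seteqP; split => w Hw i /Hw.
Qed.

Section MeasurableLogic.
Context d (T : measurableType d).
Implicit Types F : nat -> set T.

Lemma measurable_forall F : (forall i, measurable (F i)) ->
  measurable [set w | forall i, F i w].
Proof.
move=> mF; rewrite (_ : mkset _ = \bigcap_i F i); first exact: bigcapT_measurable.
by apply/seteqP; split => w H i; [move=> _|]; apply: H.
Qed.

Lemma measurable_exists F : (forall i, measurable (F i)) ->
  measurable [set w | exists i, F i w].
Proof.
move=> mF; rewrite (_ : mkset _ = \bigcup_i F i); first exact: bigcupT_measurable.
by apply/seteqP; split => w [i]; [exists i|exists i].
Qed.

Lemma measurable_imp (Q : Prop) (A : set T) : measurable A ->
  measurable [set w | Q -> A w].
Proof.
move=> mA; have [h|h] := pselect Q.
  by rewrite (_ : mkset _ = A)//; apply/seteqP; split => [w /(_ h)|w Aw _].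
by rewrite (_ : mkset _ = setT)//; apply/seteqP; split => w // _ /h.
Qed.

Lemma measurable_and (Q : Prop) (A : set T) : measurable A ->
  measurable [set w | Q /\ A w].
Proof.
move=> mA; have [h|h] := pselect Q.
  by rewrite (_ : mkset _ = A)//; apply/seteqP; split => w //= [].
by rewrite (_ : mkset _ = set0)//; apply/seteqP; split => w [].
Qed.

(** Disjointifying a cover turns an event into countably many disjoint pieces,
    each inside a member of the cover; the next two lemmas compare two events
    piece by piece. *)
Lemma measure_seqDU (R : realType) (mu : {measure set T -> \bar R})
    (A : set T) F : measurable A -> (forall n, measurable (F n)) ->
  A `<=` \bigcup_n F n -> mu A = (\sum_(n <oo) mu (A `&` seqDU F n))%E.
Proof.
move=> mA mF AF; rewrite -[in LHS](setIidl AF) seqDU_bigcup_eq setI_bigcupr.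
rewrite measure_bigcup//.
- by apply: eq_eseriesl => n; rewrite in_setT.
- by move=> n _; apply: measurableI => //; exact: seqDU_measurable.
- exact/trivIset_setIl/trivIset_seqDU.
Qed.

Lemma measure_piecewise_scale (R : realType) (mu : {measure set T -> \bar R})
    (c : R) (A B : set T) F : 0 <= c -> measurable A -> measurable B ->
  (forall n, measurable (F n)) ->
  A `<=` \bigcup_n F n -> B `<=` \bigcup_n F n ->
  (forall n, mu (A `&` seqDU F n) = c%:E * mu (B `&` seqDU F n))%E ->
  (mu A = c%:E * mu B)%E.
Proof.
move=> c0 mA mB mF AF BF H.
rewrite (measure_seqDU mu mA mF AF) (measure_seqDU mu mB mF BF).
by rewrite -nneseriesZl//; apply: eq_eseriesr => n _; rewrite H.
Qed.

Lemma measure_piecewise_le (R : realType) (mu : {measure set T -> \bar R})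
    (c : R) (A B : set T) F : 0 <= c -> measurable A -> measurable B ->
  (forall n, measurable (F n)) ->
  A `<=` \bigcup_n F n -> B `<=` \bigcup_n F n ->
  (forall n, mu (A `&` seqDU F n) <= c%:E * mu (B `&` seqDU F n))%E ->
  (mu A <= c%:E * mu B)%E.
Proof.
move=> c0 mA mB mF AF BF H.
rewrite (measure_seqDU mu mA mF AF) (measure_seqDU mu mB mF BF).
by rewrite -nneseriesZl//; apply: lee_nneseries => n _; [by []|exact: H].
Qed.

End MeasurableLogic.

Lemma measurable_ord_forall d (T : measurableType d) n (F : 'I_n -> set T) :
  (forall k, measurable (F k)) -> measurable [set w | forall k, F k w].
Proof.
move=> mF; rewrite (_ : mkset _ = \bigcap_(k in [set: 'I_n]) F k).
  by apply: fin_bigcap_measurable => // ; exact: finite_finset.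
by apply/seteqP; split => w H k; [move=> _|]; apply: H.
Qed.

Section CountableClasses.
Context d (T : measurableType d) (C : countType) (cl : T -> C).
Hypothesis mcl : forall c, measurable (cl @^-1` [set c]).

(** The special case of a countable partition, given by the fibres of [cl]. *)
Lemma measure_classes_scale (R : realType) (mu : {measure set T -> \bar R})
    (k : R) (A B : set T) : 0 <= k -> measurable A -> measurable B ->
  (forall c, mu (A `&` cl @^-1` [set c]) = k%:E * mu (B `&` cl @^-1` [set c]))%E ->
  (mu A = k%:E * mu B)%E.
Proof.
move=> k0 mA mB H.
pose F n := if choice.unpickle n is Some c then cl @^-1` [set c] else set0.
have mF n : measurable (F n) by rewrite /F; case: choice.unpickle.
have cover w : (\bigcup_n F n) w.
  by exists (choice.pickle (cl w)) => //; rewrite /F choice.pickleK.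
apply: (measure_piecewise_scale (F := F)) => // n.
have [c seqc] : exists c, seqDU F n = cl @^-1` [set c] \/ seqDU F n = set0.
  case e : (choice.unpickle n) => [c|]; last first.
    exists (cl point); right; apply/seteqP; split => // w [].
    by rewrite /F e.
  exists c; have [[w wn]|wn] := pselect (seqDU F n !=set0); last first.
    by right; apply/seteqP; split => // w Fw; apply: wn; exists w.
  left; apply/seteqP; split => z; first by case=> Fz _; move: Fz; rewrite /F e.
  have wc : cl w = c by case: wn => Fw _; move: Fw; rewrite /F e.
  move=> zc; split; first by rewrite /F e.
  case: wn => _; apply: contra_not; rewrite -!bigcup_mkord => -[i ilt Fz].
  exists i => //; move: Fz; rewrite /F; case: choice.unpickle => //= c'.
  by rewrite zc wc.
by case: seqc => ->; rewrite ?H// !setI0 !measure0 mule0.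
Qed.

Lemma measurable_fun_classes d' (U : measurableType d') (f : C -> T -> U) :
  (forall c, measurable_fun setT (f c)) -> measurable_fun setT (fun w => f (cl w) w).
Proof.
move=> mf _ A mA; rewrite setTI.
rewrite (_ : _ @^-1` _ = \bigcup_c (cl @^-1` [set c] `&` f c @^-1` A)).
  apply: countable_bigcupT_measurable => [|c]; first exact: countableP.
  by apply: measurableI => //; rewrite -[X in measurable X]setTI; exact: mf.
by apply/seteqP; split => [w fw|w [c _ [<-]]//]; exists (cl w).
Qed.

End CountableClasses.

Section ProductSpace.
Context (I : Type) d' (U : measurableType d').

Lemma measurable_coord i : measurable_fun setT (fun x : prod_space I U => x i).
Proof.
move=> _ A mA; rewrite setTI; apply: sub_sigma_algebra.
by exists i => //; exists A => //; rewrite setTI.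
Qed.

Lemma measurable_fun_prod_space d (T : measurableType d) (X : T -> prod_space I U) :
  (forall i, measurable_fun setT (fun w => X w i)) -> measurable_fun setT X.
Proof.
move=> mX; apply: (@measurability _ _ _ (prod_space I U) setT X (@cylinders I _ U) erefl).
move=> _ [_ [i _ [A mA <-]] <-]; rewrite !setTI.
by rewrite -[X in measurable X]setTI; exact: mX.
Qed.

End ProductSpace.

Section SequenceSpace.
Context d' (U : measurableType d') (R : realType).

Definition coord (i : nat) (x : prod_space nat U) : U := x i.

(** Boxes of finitely many coordinates are stable under intersection and
    generate the product sigma-algebra. *)
Lemma sequence_measure_unique (m1 m2 : {measure set (prod_space nat U) -> \bar R}) :
  (m1 setT < +oo)%E ->
  (forall n A, (forall i, measurable (A i)) ->
    m1 (box_event coord n A) = m2 (box_event coord n A)) ->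
  forall B, measurable B -> m1 B = m2 B.
Proof.
move=> m1oo m12.
pose G : set (set (prod_space nat U)) :=
  [set B | exists n A, (forall i, measurable (A i)) /\ B = box_event coord n A].
apply: (measure_unique G (fun=> setT)) => //.
- apply/seteqP; split; apply: smallest_sub; [exact: smallest_sigma_algebra| |
    exact: sigma_algebra_measurable|].
    move=> _ [i _ [A mA <-]]; apply: sub_sigma_algebra.
    exists i.+1, (fun j => if j == i then A else setT); split.
      by move=> j; case: ifP.
    rewrite setTI; apply/seteqP; split => x /= Hx.
      by move=> j _; case: ifPn => // /eqP ->.
    by have := Hx i (ltnSn i); rewrite eqxx.
  move=> _ [n [A [mA ->]]]; apply: measurable_box_event => // i.
  exact: measurable_coord.
- move=> _ _ [n [A [mA ->]]] [m [B [mB ->]]].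
  exists (maxn n m), (fun i => [set u | ((i < n)%N -> A i u) /\ ((i < m)%N -> B i u)]).
  split.
    by move=> i; apply: measurableI; exact: measurable_imp.
  apply/seteqP; split => x /=.
    by move=> [xA xB] i _; split => [/xA|/xB].
  move=> xAB; split => i ilt; have [] := xAB i.
  + by rewrite leq_max ilt.
  + by move=> /(_ ilt).
  + by rewrite leq_max ilt orbT.
  + by move=> _ /(_ ilt).
- by move=> n; exists 0%N, (fun=> setT); split => //; apply/seteqP; split.
- by apply/seteqP; split => // x _; exists 0%N.
- by move=> _ [n [A [mA ->]]]; exact: m12.
Qed.

(** Shears acting on coordinate i preserve such events, so the law of coordinate
    i can be studied conditionally on them. *)
Definition avoids (i : nat) (B : set (prod_space nat U)) : Prop :=
  forall x y, (forall k, k <> i -> x k = y k) -> B x -> B y.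

Lemma avoidsI i A B : avoids i A -> avoids i B -> avoids i (A `&` B).
Proof. by move=> hA hB x y xy [/hA Ax /hB Bx]; split; [exact: Ax|exact: Bx]. Qed.

Lemma avoids_seqDU i (F : nat -> set (prod_space nat U)) n :
  (forall n, avoids i (F n)) -> avoids i (seqDU F n).
Proof.
move=> hF x y xy [Fx nFx]; split; first exact: hF xy Fx.
apply: contra_not nFx; rewrite -!bigcup_mkord => -[k kn Fy].
by exists k => //; apply: hF Fy => l li; rewrite xy.
Qed.

End SequenceSpace.

(** * Valuation and balls of a local field *)

Section Valuation.
Context {R : realType} {K : topologicalFieldType}.
Variables (v : K -> R) (q : nat).
Hypothesis hv : normalized_valuation v q.

Lemma residue_card_gt1 : (1 < q)%N.
Proof.
have [p [c [pp c0 ->]]] := nv_prime_power hv.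
by rewrite -(exp1n c) ltn_exp2r// prime_gt1.
Qed.

Definition radius (k : int) : R := q%:R ^ (- k).

Lemma residue_natr_gt1 : 1 < q%:R :> R.
Proof. by rewrite ltr1n residue_card_gt1. Qed.

Lemma residue_natr_neq0 : q%:R != 0 :> R.
Proof. by rewrite gt_eqF// (lt_trans ltr01 residue_natr_gt1). Qed.

Lemma radius_gt0 k : 0 < radius k.
Proof. by rewrite exprz_gt0// (lt_trans ltr01 residue_natr_gt1). Qed.

Lemma radius0 : radius 0 = 1.
Proof. by rewrite /radius oppr0 expr0z. Qed.

Lemma radiusD k l : radius (k + l) = radius k * radius l.
Proof. by rewrite /radius opprD expfzDr// residue_natr_neq0. Qed.

Lemma radiusV k : (radius k)^-1 = radius (- k).
Proof. by rewrite /radius invr_expz. Qed.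

Lemma le_radius k l : (radius k <= radius l) = (l <= k).
Proof. by rewrite /radius ler_eXz2l ?residue_natr_gt1// lerN2. Qed.

Lemma lt_radius k l : (radius k < radius l) = (l < k).
Proof. by rewrite /radius ltr_eXz2l ?residue_natr_gt1// ltrN2. Qed.

Lemma radius_inj : injective radius.
Proof.
move=> k l kl; apply/eqP; rewrite eq_le -!le_radius.
by rewrite kl lexx.
Qed.

Lemma radius_nat (k : nat) : radius k = (q ^ k)%:R^-1.
Proof. by rewrite /radius natrX exprnP invr_expz. Qed.

Lemma exists_radius_lt (e : R) : 0 < e -> exists k : nat, radius k < e.
Proof.
move=> e0; pose N := Num.truncn e^-1; exists N.+1.
rewrite radius_nat invf_plt ?posrE//; last first.
  by rewrite ltr0n expn_gt0 (ltnW residue_card_gt1).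

have := truncn_itv (_ : 0 <= e^-1); rewrite invr_ge0 (ltW e0) => /(_ isT)/andP[_].
move=> /lt_le_trans; apply.
by rewrite ler_nat; apply: ltnW; exact: ltn_expl residue_card_gt1.
Qed.

Lemma val0 : v 0 = 0.
Proof. by apply/(nv_eq0 hv). Qed.

Lemma val_spec x : v x = 0 \/ exists m, v x = radius m.
Proof.
have : range v (v x) by exists x.
rewrite (nv_range hv) => -[->|[m _ <-]]; first by left.
by right; exists (- m); rewrite /radius opprK.
Qed.

Lemma val_ge0 x : 0 <= v x.
Proof. by have [->//|[m ->]] := val_spec x; rewrite ltW// radius_gt0. Qed.

Lemma val_eq0 x : (v x == 0) = (x == 0).
Proof. by apply/eqP/eqP => /(nv_eq0 hv). Qed.

Lemma val_gt0 x : (0 < v x) = (x != 0).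
Proof. by rewrite lt_def val_ge0 andbT val_eq0. Qed.

Lemma valM x y : v (x * y) = v x * v y. Proof. exact: (nv_mul hv). Qed.

Lemma val1 : v 1 = 1.
Proof.
have /eqP := valM 1 1; rewrite mulr1 -{1}(mulr1 (v 1)) eq_sym.
have v1 : v 1 != 0 by rewrite val_eq0 oner_eq0.
by rewrite (inj_eq (mulfI v1)) => /eqP.
Qed.

Lemma valN x : v (- x) = v x.
Proof.
suff -> : v (- x) = v (-1) * v x.
  have : v (-1) ^+ 2 = 1 by rewrite expr2 -valM mulrNN mulr1 val1.
  by move=> /eqP; rewrite sqrp_eq1 ?val_ge0// => /eqP ->; rewrite mul1r.
by rewrite -valM mulN1r.
Qed.

Lemma valV x : v x^-1 = (v x)^-1.
Proof.
have [->|x0] := eqVneq x 0; first by rewrite invr0 val0 invr0.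
apply: (@mulfI _ (v x)); first by rewrite val_eq0.
by rewrite -valM !divff ?val1// val_eq0.
Qed.

Lemma valD_le x y r : v x <= r -> v y <= r -> v (x + y) <= r.
Proof.
by move=> xr yr; rewrite (le_trans (nv_add hv x y))// ge_max xr yr.
Qed.

Lemma valB_le x y r : v x <= r -> v y <= r -> v (x - y) <= r.
Proof. by move=> xr yr; apply: valD_le; rewrite ?valN. Qed.

Lemma valC x y : v (x - y) = v (y - x).
Proof. by rewrite -valN opprB. Qed.

Lemma val_sum_le (I : Type) (r : seq I) (P : pred I) (F : I -> K) (e : R) :
  0 <= e -> (forall i, P i -> v (F i) <= e) -> v (\sum_(i <- r | P i) F i) <= e.
Proof.
move=> e0 Fe; elim/big_ind : _ => //; first by rewrite val0.
by move=> x y; exact: valD_le.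
Qed.

(** In an ultrametric triangle the two largest sides are equal, so the valuation
    is locally constant away from 0. *)
Lemma val_eq_of_near x y : v (x - y) < v x -> v y = v x.
Proof.
move=> xy; apply/eqP; rewrite eq_le; apply/andP; split.
  by have := @valB_le x (x - y) (v x) (lexx _) (ltW xy); rewrite subKr.
rewrite leNgt; apply/negP => yx.
have : v x <= Num.max (v (x - y)) (v y).
  by have := nv_add hv (x - y) y; rewrite subrK.
by rewrite le_max !leNgt xy yx.
Qed.

(** The valuation is discrete, so strict bounds are closed bounds one level up. *)
Lemma val_lt_radius x (m : int) : (v x < radius m) = (v x <= radius (m + 1)).
Proof.
have [->|[k ->]] := val_spec x; first by rewrite radius_gt0 ltW// radius_gt0.
by rewrite lt_radius le_radius lezD1.
Qed.

(** The level k is an exponent: larger levels are smaller balls. *)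
Definition vball (b : K) (k : int) : set K := [set x | v (x - b) <= radius k].

Lemma vball0E k : vball 0 k = [set x | v x <= radius k].
Proof. by apply/funext => x; rewrite /vball /= subr0. Qed.

Lemma ring_of_integersE : ring_of_integers v = vball 0 0.
Proof. by rewrite vball0E radius0. Qed.

Lemma vball_center b k : vball b k b.
Proof. by rewrite /vball/= subrr val0 ltW// radius_gt0. Qed.

Lemma vball_trans b c x k : v (b - c) <= radius k -> vball b k x -> vball c k x.
Proof.
move=> bc xb; rewrite /vball/= -[x - c](subrKA b).
exact: valD_le.
Qed.

Lemma vball_eq b c k : v (b - c) <= radius k -> vball b k = vball c k.
Proof.
move=> bc; apply/seteqP; split => x; first exact: vball_trans.
by apply: vball_trans; rewrite valC.
Qed.

Lemma vball_le b k l : l <= k -> vball b k `<=` vball b l.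
Proof. by move=> lk x /= /le_trans; apply; rewrite le_radius. Qed.

Lemma vball_disjoint_or_sub b k c l :
  vball b k `&` vball c l = set0 \/
  (vball b k `&` vball c l = vball b k \/ vball b k `&` vball c l = vball c l).
Proof.
have [?|/set0P[x [xb xc]]] := eqVneq (vball b k `&` vball c l) set0; [by left|right].
rewrite -(vball_eq xb) -(vball_eq xc).
by have [kl|/ltW lk] := leP k l; [right; apply: setIidr|left; apply: setIidl];
  exact: vball_le.
Qed.

Lemma vball_open b k : open (vball b k).
Proof.
rewrite openE => x xb; rewrite /interior; apply/(nv_nbhs hv).
exists (radius k); first exact: radius_gt0.
by move=> y /= /ltW yx; rewrite -(vball_eq xb).
Qed.

Lemma nbhs_vball x (A : set K) : nbhs x A <-> exists k : nat, vball x k `<=` A.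
Proof.
rewrite (nv_nbhs hv); split => [[e e0 eA]|[k kA]].
  have [k ke] := exists_radius_lt e0; exists k => y yx.
  by apply: eA; exact: le_lt_trans yx ke.
by exists (radius k); [exact: radius_gt0|move=> y /ltW; exact: kA].
Qed.

Section Uniformizer.
Variable rho : K.
Hypothesis hrho : v rho = q%:R^-1.

Lemma val_rhoz m : v (rho ^ m) = radius m.
Proof.
have h (k : nat) : v (rho ^+ k) = radius k.
  elim: k => [|k IH]; first by rewrite expr0 val1 radius0.
  by rewrite exprS valM IH hrho intS radiusD /radius -[q%:R ^ (-1)]/(q%:R^-1).
case: m => k; first by rewrite -exprnP h.
by rewrite NegzE -exprnN valV h radiusV.
Qed.

Lemma rho_neq0 : rho != 0.
Proof. by rewrite -val_gt0 hrho invr_gt0 (lt_trans ltr01 residue_natr_gt1). Qed.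

Lemma rhoz_neq0 m : rho ^ m != 0.
Proof. by rewrite -val_gt0 val_rhoz radius_gt0. Qed.

Lemma rhoz_inj : injective (fun m : int => rho ^ m).
Proof. by move=> m n /= /(congr1 v); rewrite !val_rhoz => /radius_inj. Qed.

Lemma scale_vball c b m k : v c = radius m ->
  [set x | vball (c * b) (m + k) (c * x)] = vball b k.
Proof.
move=> cm; apply/funext => x; rewrite /vball/= -mulrBr valM cm radiusD.
by rewrite ler_pM2l// radius_gt0.
Qed.

Lemma residue_representatives : exists s : 'I_q -> K,
  [/\ forall t, v (s t) <= 1,
      forall x, v x <= 1 -> exists t, v (x - s t) <= radius 1 &
      forall t t', v (s t - s t') <= radius 1 -> t = t'].
Proof.
have /card_esym := nv_residue hv hrho.
move/card_set_bijP => [f [fun_f inj_f surj_f]].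
have H (t : 'I_q) : exists x, v x <= 1 /\
    f t = [set x + rho * y | y in ring_of_integers v].
  by have [x vx fx] := fun_f t (ltn_ord t); exists x.
have [s Hs] := choice H; exists s.
have in1 x y : v (x - y) <= radius 1 <->
    [set x + rho * z | z in ring_of_integers v] =
    [set y + rho * z | z in ring_of_integers v].
  have coset w : [set w + rho * z | z in ring_of_integers v] = vball w 1.
    apply/seteqP; split => [_ [z /= z1 <-]|z zw].
      rewrite /vball/= addrAC subrr add0r valM -[v rho]/(v (rho ^ 1)) val_rhoz.
      by rewrite ler_piMr// ltW// radius_gt0.
    exists (rho^-1 * (z - w)); last by rewrite mulVKf ?rho_neq0// addrC subrK.
    rewrite /ring_of_integers/= valM valV -[v rho]/(v (rho ^ 1)) val_rhoz.
    by rewrite ler_pdivrMl ?radius_gt0// mulr1.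
  rewrite !coset; split => [|xy]; first exact: vball_eq.
  by have := vball_center x 1; rewrite xy.
split => [t|x x1|t t' /in1].
- by have [] := Hs t.
- have [|t /= tq ft] := surj_f [set x + rho * y | y in ring_of_integers v].
    by exists x.
  exists (Ordinal tq); apply/in1; rewrite -ft.
  by have [_ <-] := Hs (Ordinal tq).
- have [_ <-] := Hs t; have [_ <-] := Hs t' => ff.
  by apply/val_inj/inj_f; rewrite ?inE//=.
Qed.

(** Digit expansions of length k: a coset modulo rho ^ k.+1 is determined by a
    residue and by a coset modulo rho ^ k of the quotient by rho. *)
Lemma representatives (k : nat) : exists (T : finType) (s : T -> K),
  [/\ #|T| = (q ^ k)%N, forall t, v (s t) <= 1,
      forall x, v x <= 1 -> exists t, v (x - s t) <= radius k &
      forall t t', v (s t - s t') <= radius k -> t = t'].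
Proof.
have [r [r1 rsurj rinj]] := residue_representatives.
elim: k => [|k [T [s [cT s1 ssurj sinj]]]].
  exists unit, (fun=> 0); split => //.
  - by rewrite card_unit.
  - by move=> _; rewrite val0.
  - by move=> x x1; exists tt; rewrite subr0 radius0.
  - by move=> [] [].
exists ('I_q * T)%type, (fun t => r t.1 + rho * s t.2).
have vrho : v rho = radius 1 by rewrite -[rho]expr1z val_rhoz.
have rs x : v x <= 1 -> v (rho * x) <= radius 1.
  by move=> ?; rewrite valM vrho ler_piMr// ltW// radius_gt0.
have r1' : radius 1 <= 1 by rewrite -radius0 le_radius.
split => [|[t u]/=|x x1|[t u] [t' u']/=].
- by rewrite card_prod card_ord cT expnS.
- by apply: valD_le => //; rewrite (le_trans (rs _ _)).
- have [t tx] := rsurj x x1.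
  have [|u ux] := ssurj (rho^-1 * (x - r t)).
    by rewrite valM valV vrho ler_pdivrMl ?radius_gt0// mulr1.
  exists (t, u) => /=.
  rewrite (_ : _ - _ = rho * (rho^-1 * (x - r t) - s u)).
    by rewrite valM vrho intS radiusD ler_pM2l// radius_gt0.
  by rewrite mulrBr mulVKf ?rho_neq0// opprD addrA.
- move=> H; have tt' : t = t'.
    apply: rinj; rewrite (_ : _ - _ = (r t + rho * s u - (r t' + rho * s u'))
      - (rho * (s u - s u'))); last by rewrite mulrBr; ring.
    apply: valB_le; last by rewrite rs// valB_le.
    by rewrite (le_trans H)// le_radius lez_nat.
  rewrite -tt' in H *; congr pair; apply: sinj; move: H.
  rewrite (_ : _ - _ = rho * (s u - s u')); last by ring.
  by rewrite valM vrho intS radiusD ler_pM2l// radius_gt0.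
Qed.

(** All finite expansions, starting from any negative power of rho, are countably
    many and dense. *)
Lemma dense_sequence : exists s : nat -> K,
  forall x (k : int), exists t, v (x - s t) <= radius k.
Proof.
have /choice[r Hr] : forall k : nat, exists r : nat -> K,
    forall x, v x <= 1 -> exists t, v (x - r t) <= radius k.
  move=> k; have [T [s [_ _ ssurj _]]] := representatives k.
  exists (fun n => oapp s 0 (ohead (drop n (enum T)))) => x x1.
  have [t xt] := ssurj x x1.
  exists (index t (enum T)).
  suff -> : ohead (drop (index t (enum T)) (enum T)) = Some t by [].
  have te : (index t (enum T) < size (enum T))%N by rewrite index_mem mem_enum.
  by rewrite (drop_nth t)//= nth_index// mem_enum.
exists (fun n => oapp (fun a : nat * nat * nat => rho ^ (- (a.1.1 : int)) * r a.1.2 a.2) 0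
  (choice.unpickle n)) => x k.
have [l xl] : exists l : nat, v (rho ^ l * x) <= 1.
  have [->|x0] := eqVneq x 0; first by exists 0%N; rewrite mulr0 val0.
  have [|l lx] := @exists_radius_lt ((v x)^-1); first by rewrite invr_gt0 val_gt0.
  by exists l; rewrite valM val_rhoz -ler_pdivlMr ?val_gt0// div1r ltW.
have [t xt] := Hr (`|k| + l)%N _ xl.
exists (choice.pickle ((l, `|k| + l)%N, t)); rewrite choice.pickleK/=.
rewrite -[x in x - _]mul1r -(@mulVf _ (rho ^ l)) ?rhoz_neq0// -invr_expz.
rewrite -mulrA -mulrBr valM valV val_rhoz ler_pdivrMl ?radius_gt0// -radiusD.
by rewrite (le_trans xt)// le_radius PoszD addrC lerD2r abszE ler_norm.
Qed.

End Uniformizer.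
End Valuation.

(** * Borel sets and measures of cosets *)

Section BorelSets.
Context {R : realType} {K : topologicalFieldType}.
Variables (v : K -> R) (q : nat).
Hypothesis hv : normalized_valuation v q.
Variable rho : K.
Hypothesis hrho : v rho = q%:R^-1.

Local Notation vball := (vball v q).
Local Notation radius := (@radius R q).

(** Balls of nonnegative level suffice to generate the Borel sets, and Haar
    measure gives them mass at most 1; the empty set makes the family stable
    under intersection. *)
Definition unit_vballs : set (set (borel K)) :=
  [set A | A = set0 \/ exists b (k : nat), A = vball b k].

Lemma measurable_vball b k : measurable (vball b k : set (borel K)).
Proof. by apply: sub_sigma_algebra; exact: vball_open hv _ _. Qed.

Lemma measurable_singleton (x : K) : measurable ([set x] : set (borel K)).
Proof.
rewrite (_ : [set x] = \bigcap_(k : nat) vball x k).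
  by apply: bigcapT_measurable => k; exact: measurable_vball.
apply/seteqP; split => [_ -> k _|y xy]; first exact: vball_center.
apply/eqP; rewrite -subr_eq0 -(val_eq0 hv); apply/eqP/le_anti.
rewrite (val_ge0 hv) andbT leNgt; apply/negP => /(exists_radius_lt hv)[k].
by rewrite ltNge => /negP; apply; exact: xy.
Qed.

Lemma borel_generated_by_vballs :
  measurable = <<s unit_vballs >> :> set (set (borel K)).
Proof.
apply/seteqP; split; last first.
  apply: smallest_sub; first exact: sigma_algebra_measurable.
  by move=> _ [->|[b [k ->]]]; [exact: measurable0|exact: measurable_vball].
apply: smallest_sub; first exact: smallest_sigma_algebra.
move=> U oU.
have [s Hs] := dense_sequence hv hrho.
pose F n : set K := if choice.unpickle n is Some a then
  [set x | vball (s a.1) (a.2 : nat) `<=` U /\ vball (s a.1) (a.2 : nat) x]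
  else set0.
have -> : U = \bigcup_n F n.
  apply/seteqP; split => [x Ux|x [n _]]; last first.
    by rewrite /F; case: choice.unpickle => // a []; exact.
  have : nbhs x U by move: oU; rewrite openE; exact.
  move=> /(nbhs_vball hv)[k kU]; have [t xt] := Hs x k.
  exists (choice.pickle (t, k)) => //; rewrite /F choice.pickleK/=; split => //.
  by rewrite -(vball_eq hv xt).
apply: sigma_algebra_bigcup => n; apply: sub_sigma_algebra; rewrite /F.
case: choice.unpickle => [[t k]|]; last by left.
have [sU|nsU] := pselect (vball (s t) k `<=` U).
  by right; exists (s t), k; apply/seteqP; split => x /=; [case|].
by left; apply/seteqP; split => x //= [].
Qed.

Lemma unit_vballs_setI : setI_closed unit_vballs.
Proof.
move=> _ _ [->|[b [k ->]]] [->|[c [l ->]]]; rewrite ?set0I ?setI0; [by left..|].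
have [->|[->|->]] := vball_disjoint_or_sub hv b k c l; first by left.
- by right; exists b, k.
- by right; exists c, l.
Qed.

Lemma borel_measure_unique (m1 m2 : {measure set (borel K) -> \bar R}) :
  (forall b (k : nat), m1 (vball b k) = m2 (vball b k)) ->
  (forall b, m1 (vball b 0) < +oo)%E ->
  forall A, measurable A -> m1 A = m2 A.
Proof.
move=> m12 m1oo; have [s Hs] := dense_sequence hv hrho.
apply: (measure_unique unit_vballs (fun n => vball (s n) 0)) => //.
- exact: borel_generated_by_vballs.
- exact: unit_vballs_setI.
- by move=> n; right; exists (s n), 0%N.
- by apply/seteqP; split => x // _; have [t xt] := Hs x 0; exists t.
- by move=> _ [->|[b [k ->]]]; rewrite ?measure0.
Qed.

Lemma measurable_fun_borel d (T : measurableType d) (f : T -> borel K) :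
  (forall b (k : nat), measurable (f @^-1` (vball b k : set (borel K)))) ->
  measurable_fun setT f.
Proof.
move=> H; apply: (measurability _ borel_generated_by_vballs).
move=> _ [_ [->|[b [k ->]]] <-]; rewrite setTI; last exact: H.
by rewrite preimage_set0; exact: measurable0.
Qed.

Lemma measurable_preimage_vball d (T : measurableType d) (f : T -> borel K) b k :
  measurable_fun setT f -> measurable (f @^-1` (vball b k : set (borel K))).
Proof.
by move=> mf; rewrite -[X in measurable X]setTI; apply: mf => //;
  exact: measurable_vball.
Qed.

(** Measurability of a sum from that of its terms rests on second countability:
    a sum lies in a ball exactly when, for some element of a dense sequence, the
    first term is near it and the second near the difference. *)
Lemma measurable_fun_borelD d (T : measurableType d) (f g : T -> borel K) :
  measurable_fun setT f -> measurable_fun setT g ->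
  measurable_fun setT (fun w => ((f w : K) + (g w : K) : K) : borel K).
Proof.
move=> mf mg; apply: measurable_fun_borel => b k.
have [s Hs] := dense_sequence hv hrho.
rewrite (_ : _ @^-1` _ = \bigcup_t (f @^-1` (vball (s t) k : set (borel K)) `&`
    g @^-1` (vball (b - s t) k : set (borel K)))).
  by apply: bigcupT_measurable => t; apply: measurableI;
    exact: measurable_preimage_vball.
apply/seteqP; split => [w wb|w [t _ [ft gt]]].
  have [t ft] := Hs (f w) k; exists t => //; split => //.
  rewrite /preimage /vball/=.
  rewrite (_ : _ - _ = ((f w : K) + (g w : K) - b) - ((f w : K) - s t)); last by ring.
  exact: (valB_le hv wb ft).
rewrite /preimage /vball/=.
rewrite (_ : _ - _ = ((f w : K) - s t) + ((g w : K) - (b - s t))); last by ring.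
exact: (valD_le hv ft gt).
Qed.

Lemma measurable_fun_borelZ d (T : measurableType d) (c : K) (f : T -> borel K) :
  measurable_fun setT f ->
  measurable_fun setT (fun w => (c * (f w : K) : K) : borel K).
Proof.
move=> mf; have [->|c0] := eqVneq c 0.
  by rewrite (_ : (fun _ => _) = cst (0 : K))//; apply/funext => w; rewrite mul0r.
apply: measurable_fun_borel => b k.
have [|[m cm]] := val_spec hv c; first by move=> /eqP; rewrite (val_eq0 hv) (negbTE c0).
rewrite (_ : _ @^-1` _ = f @^-1` (vball (c^-1 * b) (k%:Z - m) : set (borel K))).
  exact: measurable_preimage_vball.
apply/funext => w; rewrite /preimage/vball/=.
rewrite -{1}(mulVKf c0 b) -mulrBr (valM hv) cm (radiusD hv) mulrC.
by rewrite -radiusV ler_pdivlMr// (radius_gt0 hv).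
Qed.

Lemma measurable_fun_borel_sum d (T : measurableType d) n (c : 'I_n -> K)
    (f : 'I_n -> T -> borel K) : (forall i, measurable_fun setT (f i)) ->
  measurable_fun setT (fun w => (\sum_i c i * (f i w : K) : K) : borel K).
Proof.
move=> mf.
elim: n => [|n IH] in c f mf *.
  rewrite (_ : (fun _ => _) = cst (0 : K))//; apply/funext => w.
  by rewrite big_ord0.
under eq_fun do rewrite big_ord_recl.
apply: measurable_fun_borelD; first exact: measurable_fun_borelZ.
by apply: (IH (fun i => c (lift ord0 i)) (fun i => f (lift ord0 i))).
Qed.

(** If the q ^ k cosets of rho ^ (m + k) D in rho ^ m D are equally likely values
    of f, each gets a fraction q ^ (- k) of the mass of the event f in rho ^ m D. *)
Lemma equal_cosets d (T : measurableType d) (mu : {measure set T -> \bar R})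
    (B : set T) (f : T -> borel K) (m : int) (k : nat) :
  measurable B -> measurable_fun setT f ->
  (forall b, v b <= radius m ->
    mu (B `&` f @^-1` (vball b (m + k) : set (borel K))) =
    mu (B `&` f @^-1` (vball 0 (m + k) : set (borel K)))) ->
  forall b, v b <= radius m ->
    mu (B `&` f @^-1` (vball b (m + k) : set (borel K))) =
    ((radius k)%:E * mu (B `&` f @^-1` (vball 0%R m : set (borel K))))%E.
Proof.
move=> mB mf H b vb; rewrite H//.
have [I [s [cI s1 ssurj sinj]]] := representatives hv hrho k.
pose F t := B `&` f @^-1` (vball (rho ^ m * s t) (m + k) : set (borel K)).
have mF t : measurable (F t).
  by apply: measurableI => //; exact: measurable_preimage_vball.
have vrs x : v x <= 1 -> v (rho ^ m * x) <= radius m.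
  by move=> x1; rewrite (valM hv) (val_rhoz hv hrho) ler_piMr// ltW// (radius_gt0 hv).
have -> : B `&` f @^-1` (vball 0 m : set (borel K)) = \bigcup_(t in [set: I]) F t.
  apply/seteqP; split => [w [Bw fw]|w [t _ [Bw fw]]]; last first.
    split => //; rewrite /preimage; apply: (vball_trans hv (b := rho ^ m * s t)).
      by rewrite subr0 vrs.
    by apply: vball_le fw => //; rewrite lerDl.
  have [|t ft] := ssurj (rho ^ (- m) * f w).
    rewrite (valM hv) (val_rhoz hv hrho) -radiusV ler_pdivrMl ?(radius_gt0 hv)//.
    by rewrite mulr1; move: fw; rewrite /preimage/vball/= subr0.
  exists t => //; split => //; rewrite /preimage/=.
  have -> : f w = rho ^ m * (rho ^ (- m) * f w).
    by rewrite -invr_expz mulVKf// (rhoz_neq0 hv hrho).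
  have := scale_vball hv (s t) k (val_rhoz hv hrho m).
  by move=> /(congr1 (fun A => A (rho ^ (- m) * f w))) /= ->.
rewrite measure_fin_bigcup//.
- have -> : [set: I] = [set` enum I].
    by apply/seteqP; split => t //= _; rewrite mem_enum.
  rewrite -fsbig_seq ?enum_uniq//= big_enum/=.
  rewrite (eq_bigr (fun=> mu (B `&` f @^-1` (vball 0 (m + k) : set (borel K))))).
    rewrite ge0_sume_const// cI muleA -EFinM radius_nat.
    by rewrite mulVf ?mul1e// natrX expf_neq0// (residue_natr_neq0 hv).
  by move=> t _; rewrite /F H// vrs.
- exact: finite_finset.
- move=> t t' _ _ [w [[_ wt] [_ wt']]]; apply: sinj.
  rewrite -(ler_pM2l (radius_gt0 hv m)) -(val_rhoz hv hrho m) -(valM hv).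
  rewrite (val_rhoz hv hrho) -(radiusD hv) mulrBr.
  rewrite (_ : _ - _ = (f w - rho ^ m * s t') - (f w - rho ^ m * s t)); last by ring.
  exact: (valB_le hv).
Qed.
End BorelSets.

(** * The standard Gaussian law *)

Section Gaussian.
Context {R : realType} {K : topologicalFieldType}.
Variables (v : K -> R) (q : nat).
Hypothesis hv : normalized_valuation v q.
Variable rho : K.
Hypothesis hrho : v rho = q%:R^-1.
Variable lambda : {measure set (borel K) -> \bar R}.
Hypothesis hlambda : haar_measure lambda.
Hypothesis hlambda1 : lambda (ring_of_integers v) = 1%E.

Local Notation vball := (vball v q).
Local Notation radius := (@radius R q).
Local Notation gamma := (gamma v lambda).

Lemma translate_vball c l : [set c + a | a in vball 0 l] = vball c l.
Proof.
apply/seteqP; split => [_ [x x0 <-]|x cx].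
  by rewrite /vball/= addrAC subrr add0r; move: x0; rewrite /vball/= subr0.
by exists (x - c); rewrite ?[c + _]addrC ?subrK// /vball/= subr0.
Qed.

Lemma haar_vball b (k : nat) : lambda (vball b k) = (radius k)%:E.
Proof.
have trans c (l : int) : lambda (vball c l) = lambda (vball 0 l).
  rewrite -(haar_translation hlambda c (measurable_vball hv 0 l)).
  by congr (lambda _); rewrite translate_vball.
have := @equal_cosets _ _ _ _ hv _ hrho _ _ lambda setT id 0 k measurableT
  (@measurable_id _ _ setT) _ 0.
rewrite !setTI !preimage_id add0r trans => ->.
- by rewrite -ring_of_integersE// hlambda1 mule1.
- by move=> c _; rewrite !setTI !preimage_id trans.
- by rewrite (val0 hv) radius0.
Qed.

Lemma gaussian_probability :
  exists G : probability (borel K) R, forall A, G A = gamma A.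
Proof.
have mD : measurable (ring_of_integers v : set (borel K)).
  by rewrite (ring_of_integersE v q); exact: measurable_vball.
have G1 : mrestr lambda mD setT = 1%E by rewrite /mrestr setTI hlambda1.
pose G' : probability (borel K) R := HB.pack (mrestr lambda mD)
  (Measure_isProbability.Build _ _ _ (mrestr lambda mD) G1).
by exists G'.
Qed.

Lemma gamma_setT : gamma setT = 1%E.
Proof. by rewrite /gamma setTI. Qed.

Lemma gamma_ge0 A : (0 <= gamma A)%E.
Proof. by have [G <-] := gaussian_probability; exact: measure_ge0. Qed.

Lemma gamma_fin_num A : measurable A -> gamma A \is a fin_num.
Proof. by have [G <-] := gaussian_probability; exact: fin_num_measure. Qed.

Lemma gamma_vball b (k : nat) : v b <= 1 -> gamma (vball b k) = (radius k)%:E.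
Proof.
move=> b1; rewrite /gamma setIidl ?haar_vball//.
rewrite (ring_of_integersE v q) -(vball_eq hv (b := b)); first exact: vball_le.
by rewrite subr0 radius0.
Qed.

Lemma vball_disjoint_integers b (k : nat) : 1 < v b ->
  vball b k `&` ring_of_integers v = set0.
Proof.
move=> b1; apply/seteqP; split => // x [/= xb x1]; move: b1; rewrite ltNge.
rewrite -{1}(subKr x b) => /negP; apply; apply: (valB_le hv) => //.
by rewrite (le_trans xb)// -(@radius0 R q) (le_radius hv).
Qed.

Lemma gamma_vball0 b (k : nat) : 1 < v b -> gamma (vball b k) = 0%E.
Proof. by move=> /vball_disjoint_integers; rewrite /gamma => ->; exact: measure0. Qed.

(** The working criterion for conditional Gaussianity: it is enough to test
    integral balls, because they determine Borel measures. *)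
Lemma gaussian_of_vballs d (T : measurableType d) (mu : {measure set T -> \bar R})
    (B : set T) (f : T -> borel K) :
  measurable B -> (mu B < +oo)%E -> measurable_fun setT f ->
  (forall w, B w -> v (f w) <= 1) ->
  (forall b (k : nat), v b <= 1 ->
    mu (B `&` f @^-1` (vball b k)) = ((radius k)%:E * mu B)%E) ->
  forall A, measurable A -> mu (B `&` f @^-1` A) = (gamma A * mu B)%E.
Proof.
move=> mB Boo mf fB HB A mA.
have [G HG] := gaussian_probability.
have [nu Hnu] := image_restriction_measure mu mB mf.
have Bfin : mu B = (fine (mu B))%:E by rewrite fineK// ge0_fin_numE.
have c0 : 0 <= fine (mu B) by rewrite fine_ge0.
pose m2 : {measure set (borel K) -> \bar R} := mscale (NngNum c0) G.
rewrite -Hnu (borel_measure_unique hv hrho (m1 := nu) (m2 := m2))//.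
- by rewrite /m2/= /mscale/= -Bfin HG muleC.
- move=> b k; rewrite Hnu /m2/= /mscale/= -Bfin HG.
  have [b1|b1] := leP (v b) 1; first by rewrite HB// gamma_vball// muleC.
  rewrite gamma_vball0// mule0 (_ : _ `&` _ = set0) ?measure0//.
  apply/seteqP; split => // w [/fB fw fb].
  have : set0 (f w) by rewrite -(vball_disjoint_integers k b1).
  by [].
- move=> b; rewrite Hnu (le_lt_trans _ Boo)// le_measure ?inE//.
  by apply: measurableI => //; exact: measurable_preimage_vball.
Qed.

End Gaussian.

(** * An independent Gaussian sequence built from Haar measure *)

Section GaussianSequence.
Context {R : realType} {K : topologicalFieldType}.
Variables (v : K -> R) (q : nat).
Hypothesis hK : local_field v q.
Let hv : normalized_valuation v q := lf_valuation hK.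
Variable rho : K.
Hypothesis hrho : v rho = q%:R^-1.
Variable lambda : {measure set (borel K) -> \bar R}.
Hypothesis hlambda : haar_measure lambda.
Hypothesis hlambda1 : lambda (ring_of_integers v) = 1%E.

Local Notation vball := (vball v q).
Local Notation radius := (@radius R q).
Local Notation gamma := (gamma v lambda).

(** Completeness of D, from local compactness: multiplication by a power of rho
    brings the sequence into a compact neighbourhood of 0, and a cluster point of
    an ultrametric Cauchy sequence lies within the expected distance of each
    term. *)
Lemma ultrametric_limit (S : nat -> K) : v (S 0%N) <= 1 ->
  (forall n : nat, v (S n.+1 - S n) <= radius n) ->
  exists x, forall n : nat, v (x - S n) <= radius n.
Proof.
move=> S0 dS.
have dS' (n l : nat) : v (S (n + l)%N - S n) <= radius n.
  elim: l => [|l IH]; first by rewrite addn0 subrr (val0 hv) ltW// (radius_gt0 hv).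
  rewrite addnS -(subrKA (S (n + l)%N)); apply: (valD_le hv) => //.
  by rewrite (le_trans (dS _))// (le_radius hv) lez_nat leq_addr.
(* K is locally compact, and some ball of level k around 0 lies in a compact set. *)
have [U nU [cU _]] := lf_locally_compact hK (x := 0) I.
have : nbhs (0 : K) U by apply: (@filterS _ (nbhs (0 : K)) _ [set x | setT x -> U x]) nU => x; exact.
move=> /(nbhs_vball hv)[k kU].
pose S' n := rho ^ k * S n.
have S'U n : U (S' n).
  apply: kU; rewrite vball0E /= /S' (valM hv) (val_rhoz hv hrho).
  rewrite (ler_piMr (ltW (radius_gt0 hv _)))//.
  rewrite -(subrK (S 0%N) (S n)); apply: (valD_le hv) => //.
  by have := dS' 0%N n; rewrite add0n radius0.
have S'oo : (S' @ \oo) U by exists 0%N => // n _; exact: S'U.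
have [x [_ clx]] := cU (S' @ \oo) _ S'oo.
exists (rho ^ (- k%:Z) * x) => n.
have [|| _ [/= [l nl <-]]] := clx [set S' l | l in [set l | (n <= l)%N]]
    (vball x (k + n)%N).
- by exists n => // l /= nl; exists l.
- by apply/(nbhs_vball hv); exists (k + n)%N.
rewrite /vball/= => lx.
rewrite -(subrKA (S l)); apply: (valD_le hv); last by rewrite -(subnKC nl).
rewrite (valC hv) -[S l](mulVKf (rhoz_neq0 hv hrho k)) -invr_expz -mulrCA -mulrBr.
rewrite (valM hv) (valV hv) (val_rhoz hv hrho) ler_pdivrMl ?(radius_gt0 hv)//.
by rewrite -(radiusD hv).
Qed.

Lemma measurable_uniformly_continuous (f : K -> K) :
  (forall k : nat, exists l : nat, forall x y,
    v (x - y) <= radius l -> v (f x - f y) <= radius k) ->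
  measurable_fun setT (f : borel K -> borel K).
Proof.
move=> uf; apply: (measurable_fun_borel hv hrho) => b k.
apply: sub_sigma_algebra => /=; rewrite openE => x xb.
have [l fl] := uf k; apply/(nbhs_vball hv); exists l => y yx.
by apply: (vball_trans hv _ (fl _ _ yx)) => //; rewrite (valC hv); exact: xb.
Qed.

(** A residue digit for the elements of D; it can be extended, by 0, to a locally
    constant function on K. *)
Lemma exists_digit : exists rd : K -> K,
  [/\ forall x, v (rd x) <= 1,
      forall x, v x <= 1 -> v (x - rd x) <= radius 1 &
      forall x y, v (x - y) <= radius 1 -> rd x = rd y].
Proof.
have [r [r1 rsurj rinj]] := residue_representatives hv hrho.
exists (fun x => if [pick t | v (x - r t) <= radius 1] is Some t then r t else 0).
split => [x|x x1|x y xy].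
- by case: pickP => // _; rewrite (val0 hv).
- case: pickP => // nx; have [t] := rsurj x x1.
  by rewrite nx.
- rewrite (@eq_pick _ _ (fun t => v (y - r t) <= radius 1))// => t.
  have := vball_eq hv xy => /(congr1 (fun A => A (r t))).
  by rewrite /vball/= (valC hv) [in RHS](valC hv) => e; apply/idP/idP; rewrite e.
Qed.

(** T shifts the digits of x by one place and Phi keeps those of even rank:
    Phi x is the sum of the digits d_(2 n) x rho ^ n. Consequently Phi (T x) keeps
    the digits of odd rank. The recursive equation is what later proofs use. *)
Lemma interleaving_maps : exists (rd T Phi : K -> K),
  [/\ [/\ forall x, v (rd x) <= 1,
      forall x, v x <= 1 -> v (x - rd x) <= radius 1 &
      forall x y, v (x - y) <= radius 1 -> rd x = rd y],
      forall x, x = rd x + rho * T x,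
      forall x, v (Phi x) <= 1 &
      forall x, Phi x = rd x + rho * Phi (T (T x))].
Proof.
have [rd [rd1 rdN rdE]] := exists_digit.
pose T x := rho^-1 * (x - rd x).
have vrho : v rho = radius 1 by rewrite -[rho]expr1z (val_rhoz hv hrho).
(* The partial sums of the even digits; only their limit matters. *)
pose fix S n x {struct n} := if n is n'.+1 then rd x + rho * S n' (T (T x)) else 0.
have dS n : forall x, v (S n.+1 x - S n x) <= radius n.
  elim: n => [|n IH] x; first by rewrite /= mulr0 addr0 subr0 radius0.
  rewrite [S n.+2 x]/= [S n.+1 x]/= opprD addrACA subrr add0r -mulrBr.
  by rewrite (valM hv) vrho intS (radiusD hv) ler_pM2l ?(radius_gt0 hv)//; exact: IH.
have [x|Phi PhiS] := @choice _ _ (fun x y => forall n : nat, v (y - S n x) <= radius n).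
  by apply: (ultrametric_limit (S := S^~ x)) => //; rewrite [S 0%N x]/= (val0 hv).
exists rd, T, Phi; split => //.
- by move=> x; rewrite /T mulVKf ?(rho_neq0 hv hrho)// addrC subrK.
- by move=> x; have := PhiS x 0%N; rewrite subr0 radius0.
- move=> x; apply/eqP; rewrite -subr_eq0 -(val_eq0 hv); apply/eqP/le_anti.
  rewrite (val_ge0 hv) andbT leNgt; apply/negP => /(exists_radius_lt hv)[n].
  rewrite ltNge => /negP; apply.
  rewrite -(subrKA (S n.+1 x)); apply: (valD_le hv).
    by rewrite (le_trans (PhiS x n.+1))// (le_radius hv) lez_nat.
  rewrite /= opprD addrACA subrr add0r -mulrBr (valM hv) vrho (valC hv).
  rewrite (le_trans (ler_piMl _ _))// ?(val_ge0 hv)//.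
  by rewrite -(@radius0 R q) (le_radius hv).
Qed.

Section Interleaving.
Variables rd T Phi : K -> K.
Hypothesis rd1 : forall x, v (rd x) <= 1.
Hypothesis rdN : forall x, v x <= 1 -> v (x - rd x) <= radius 1.
Hypothesis rdE : forall x y, v (x - y) <= radius 1 -> rd x = rd y.
Hypothesis rdT : forall x, x = rd x + rho * T x.
Hypothesis Phi1 : forall x, v (Phi x) <= 1.
Hypothesis PhiE : forall x, Phi x = rd x + rho * Phi (T (T x)).

Let vrho : v rho = radius 1.
Proof. by rewrite -[rho]expr1z (val_rhoz hv hrho). Qed.

Lemma shift_dist (k : nat) x y : v (x - y) <= radius k.+1 -> v (T x - T y) <= radius k.
Proof.
move=> xy; have rdxy : rd x = rd y.
  by apply: rdE; rewrite (le_trans xy)// (le_radius hv) lez_nat.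
move: xy; rewrite {1}[x]rdT {1}[y]rdT rdxy opprD addrACA subrr add0r -mulrBr.
by rewrite (valM hv) vrho intS (radiusD hv) ler_pM2l// (radius_gt0 hv).
Qed.

Lemma shift_integers x : v x <= 1 -> v (T x) <= 1.
Proof.
move=> /rdN; rewrite {1}[x]rdT addrAC subrr add0r (valM hv) vrho.
by rewrite -[X in _ <= X -> _]mulr1 ler_pM2l// (radius_gt0 hv).
Qed.

Lemma measurable_shift : measurable_fun setT (T : borel K -> borel K).
Proof.
by apply: measurable_uniformly_continuous => k; exists k.+1 => x y; exact: shift_dist.
Qed.

(** The first k digits of Phi x depend on the first 2 k digits of x. *)
Lemma measurable_interleaving : measurable_fun setT (Phi : borel K -> borel K).
Proof.
apply: measurable_uniformly_continuous => k; exists k.*2.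
elim: k => [|k IH] x y xy.
  by apply: (valB_le hv); rewrite radius0.
have rdxy : rd x = rd y.
  by apply: rdE; rewrite (le_trans xy)// (le_radius hv) lez_nat.
rewrite PhiE (PhiE y) rdxy opprD addrACA subrr add0r -mulrBr.
rewrite (valM hv) vrho intS (radiusD hv) ler_pM2l ?(radius_gt0 hv)//.
by apply: IH; do 2!apply: shift_dist.
Qed.

Variable G : {measure set (borel K) -> \bar R}.
Hypothesis GE : forall A, G A = gamma A.

(** Under Haar measure the first digit is uniform and independent of the shifted
    element. *)
Lemma shift_on_coset c E : v c <= 1 -> measurable E ->
  G (vball c 1 `&` (T : borel K -> borel K) @^-1` E) = (G E * (radius 1)%:E)%E.
Proof.
move=> c1 mE; have Gc : G (vball c 1) = (radius 1)%:E.
  by rewrite GE (gamma_vball hv hrho hlambda hlambda1 1 c1).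
rewrite [G E]GE -Gc.
have cI x : vball c 1 x -> v x <= 1.
  move=> xc; rewrite -(subrK c x); apply: (valD_le hv) => //.
  by rewrite (le_trans xc)// -(@radius0 R q) (le_radius hv).
apply: (gaussian_of_vballs hv hrho hlambda hlambda1) => //.
- exact: measurable_vball.
- by rewrite Gc ltry.
- exact: measurable_shift.
- by move=> x /cI; exact: shift_integers.
move=> b k b1; rewrite Gc -EFinM -(radiusD hv).
have b'1 : v (rd c + rho * b) <= 1.
  apply: (valD_le hv) => //; rewrite (valM hv) vrho mulr_ile1 ?(val_ge0 hv)//.
    by rewrite ltW// (radius_gt0 hv).
  by rewrite -(@radius0 R q) (le_radius hv).
transitivity (G (vball (rd c + rho * b) k.+1)); last first.
  by rewrite GE (gamma_vball hv hrho hlambda hlambda1)// intS addrC.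
congr (G _); apply/seteqP; split => [x [xc]|x xb].
  rewrite /preimage/vball/= => Tb; rewrite {1}[x in x - _]rdT (rdE xc).
  rewrite opprD addrACA subrr add0r -mulrBr.
  by rewrite (valM hv) vrho intS (radiusD hv) ler_pM2l// (radius_gt0 hv).
have xc : vball c 1 x.
  have h : v (rd c + rho * b - c) <= radius 1.
    rewrite addrAC; apply: (valD_le hv); first by rewrite (valC hv) rdN.
    by rewrite (valM hv) vrho ler_piMr// ltW// (radius_gt0 hv).
  apply: (vball_trans hv h); apply: vball_le xb => //.
split => //; move: xb; rewrite /preimage/vball/= {1}[x in x - _]rdT (rdE xc).
rewrite opprD addrACA subrr add0r -mulrBr.
by rewrite (valM hv) vrho intS (radiusD hv) ler_pM2l// (radius_gt0 hv).
Qed.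

Lemma measure_in_integers A : measurable A -> G (A `&` (ring_of_integers v : set (borel K))) = G A.
Proof. by move=> mA; rewrite !GE /gamma -setIA setIid. Qed.

Lemma shift_preserves E : measurable E -> G ((T : borel K -> borel K) @^-1` E) = G E.
Proof.
move=> mE; have mTE : measurable ((T : borel K -> borel K) @^-1` E).
  by rewrite -[X in measurable X]setTI; exact: measurable_shift.
have H := @equal_cosets _ _ _ _ hv _ hrho _ _ G _ id 0 1%N mTE (@measurable_id _ _ setT).
have cosets b : v b <= 1 ->
    G ((T : borel K -> borel K) @^-1` E `&` id @^-1` (vball b (0 + 1%N))) =
    (G E * (radius 1)%:E)%E.
  by move=> b1; rewrite preimage_id setIC shift_on_coset.
(* The preimage of E meets each of the q residue classes in mass G E / q. *)
have := H _ 0; rewrite cosets ?(val0 hv)// preimage_id.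
rewrite -(ring_of_integersE v q) measure_in_integers// radius0 muleC => /(_ _ ler01).
move=> H1; apply/esym/(@pmuleI _ (radius 1)); first exact: (radius_gt0 hv).
by apply: H1 => b b1; rewrite cosets// muleC.
Qed.

Let Psi x := Phi (T x).

Lemma measurable_interleaving_odd : measurable_fun setT (Psi : borel K -> borel K).
Proof. exact: measurableT_comp measurable_interleaving measurable_shift. Qed.

(** Reading one digit exchanges the roles of even and odd ranks, whence the
    asymmetry between the two sides. *)
Lemma interleaving_vballsS (k l : nat) a b : v a <= 1 -> v b <= 1 ->
  G ((Phi : borel K -> borel K) @^-1` vball a k.+1 `&`
     (Psi : borel K -> borel K) @^-1` vball b l) =
  (G ((Phi : borel K -> borel K) @^-1` vball b l `&`
      (Psi : borel K -> borel K) @^-1` vball (T a) k) * (radius 1)%:E)%E.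
Proof.
move=> a1 b1; have mPhi := measurable_interleaving.
have mPsi := measurable_interleaving_odd.
rewrite -(shift_on_coset a1); last first.
  by apply: measurableI; exact: measurable_preimage_vball.
rewrite -measure_in_integers; last by apply: measurableI; exact: measurable_preimage_vball.
have key x : Phi x - a = (rd x - rd a) + rho * (Psi (T x) - T a).
  by rewrite PhiE {1}[a]rdT mulrBr opprD addrACA.
congr (G _); apply/seteqP; split => [x [[+ bx] x1]|x [ax [bx]]].
  rewrite /preimage/vball/= key => ax.
  have ra : v (rd x - rd a) <= radius 1.
    rewrite -[rd x - rd a](addrK (rho * (Psi (T x) - T a))); apply: (valB_le hv).
      by rewrite (le_trans ax)// (le_radius hv) lez_nat.
    rewrite (valM hv) vrho (ler_piMr (ltW (radius_gt0 hv _)))//.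
    by apply: (valB_le hv); [exact: Phi1|exact: shift_integers].
  have xa : v (x - a) <= radius 1.
    rewrite -(subrKA (rd x)) -[rd x - a](subrKA (rd a)).
    apply: (valD_le hv); first exact: rdN.
    by apply: (valD_le hv) => //; rewrite (valC hv) rdN.
  split => //; split => //.
  move: ax; rewrite /preimage/vball/= (rdE xa) subrr add0r.
  by rewrite (valM hv) vrho intS (radiusD hv) ler_pM2l// (radius_gt0 hv).
move=> aTx; split; first split => //.
  rewrite /preimage/vball/= key (rdE ax) subrr add0r.
  by rewrite (valM hv) vrho intS (radiusD hv) ler_pM2l// (radius_gt0 hv).
rewrite /ring_of_integers/= -(subrK a x); apply: (valD_le hv) => //.
by rewrite (le_trans ax)// -(@radius0 R q) (le_radius hv).
Qed.

(** By induction on the number of digits that are prescribed: each one costs a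
    factor 1/q. When the even part is unconstrained, invariance under the shift
    makes the odd part the even one. *)
Lemma interleaving_vballs (k l : nat) a b : v a <= 1 -> v b <= 1 ->
  G ((Phi : borel K -> borel K) @^-1` vball a k `&`
     (Psi : borel K -> borel K) @^-1` vball b l) = (radius (k + l)%N)%:E.
Proof.
have mPhi := measurable_interleaving.
have mPsi := measurable_interleaving_odd.
have in_integers c x : v c <= 1 -> vball c 0%N (Phi x).
  by move=> c1; rewrite /vball/= radius0; exact: (valB_le hv).
have [N] := ubnP (k + l); elim: N => // N IH in k l a b *.
case: k => [|k] klN a1 b1; last first.
  rewrite interleaving_vballsS// IH//.
  - by rewrite -EFinM -(radiusD hv) addSn addnC -PoszD addn1.
  - by rewrite addnC.
  - exact: shift_integers.
have -> : (Phi : borel K -> borel K) @^-1` vball a 0%N = setT.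
  by apply/seteqP; split => // x _; exact: in_integers.
rewrite setTI add0n.
have -> : (Psi : borel K -> borel K) @^-1` vball b l =
    (T : borel K -> borel K) @^-1` ((Phi : borel K -> borel K) @^-1` vball b l) by [].
rewrite shift_preserves; last exact: measurable_preimage_vball.
have -> : (Phi : borel K -> borel K) @^-1` vball b l =
    (Phi : borel K -> borel K) @^-1` vball b l `&`
    (Psi : borel K -> borel K) @^-1` vball 0 0%N.
  apply/seteqP; split => [x xb|x []//]; split => //.
  by apply: in_integers; rewrite (val0 hv).
case: l klN => [|l] klN.
  rewrite (_ : _ `&` _ = setT); first by rewrite GE radius0 gamma_setT.
  apply/seteqP; split => // x _; split; apply: in_integers => //.
  by rewrite (val0 hv).
rewrite interleaving_vballsS ?(val0 hv)// IH ?(val0 hv)//.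
- by rewrite -EFinM -(radiusD hv) add0n -PoszD addn1.
- exact: shift_integers.
Qed.

(** The pair of even and odd parts of a Haar-distributed integer is a pair of
    independent Haar-distributed integers. *)
Lemma interleaving_independent A B : measurable A -> measurable B ->
  G ((Phi : borel K -> borel K) @^-1` A `&` (Psi : borel K -> borel K) @^-1` B) =
  (gamma A * gamma B)%E.
Proof.
move=> mA mB.
have mPhi := measurable_interleaving.
have mPsi := measurable_interleaving_odd.
have Goo E : measurable E -> (G E < +oo)%E.
  move=> mE; apply: (@le_lt_trans _ _ (G setT)).
    by apply: le_measure; rewrite ?inE.
  by rewrite GE gamma_setT// ltey.
have mPsi_vball b (l : nat) : measurable ((Psi : borel K -> borel K) @^-1` vball b l).
  exact: measurable_preimage_vball.
have mPhiA : measurable ((Phi : borel K -> borel K) @^-1` A).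
  by rewrite -[X in measurable X]setTI; exact: mPhi.
have PhiT : (Phi : borel K -> borel K) @^-1` vball 0 0%N = setT.
  by apply/seteqP; split => // x _; rewrite /preimage/vball/= subr0 radius0.
have PsiT : (Psi : borel K -> borel K) @^-1` vball 0 0%N = setT.
  by apply/seteqP; split => // x _; rewrite /preimage/vball/= subr0 radius0; exact: Phi1.
have GPsi b (l : nat) : v b <= 1 ->
    G ((Psi : borel K -> borel K) @^-1` vball b l) = (radius l)%:E.
  move=> b1; have := interleaving_vballs 0 l (a := 0) _ b1.
  by rewrite (val0 hv) PhiT setTI add0n; exact.
have step1 b (l : nat) : v b <= 1 ->
    G ((Phi : borel K -> borel K) @^-1` A `&` (Psi : borel K -> borel K) @^-1` vball b l) =
    (gamma A * (radius l)%:E)%E.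
  move=> b1; rewrite setIC -(GPsi b l b1).
  apply: (gaussian_of_vballs hv hrho hlambda hlambda1) => //; first exact: Goo.
  move=> a k a1; rewrite setIC interleaving_vballs// GPsi//.
  by rewrite -EFinM -(radiusD hv).
have GA : G ((Phi : borel K -> borel K) @^-1` A) = gamma A.
  have := step1 0 0%N; rewrite PsiT setIT radius0 mule1 (val0 hv).
  by apply.
rewrite -[in RHS]GA muleC.
apply: (gaussian_of_vballs hv hrho hlambda hlambda1) => //; first exact: Goo.
- by move=> x _; exact: Phi1.
- by move=> b l b1; rewrite step1// GA muleC.
Qed.

End Interleaving.

(** Splitting repeatedly the odd part yields a new independent Gaussian each
    time: the i-th one is the even part of the i-th iterated odd part. *)
Lemma gaussian_sequence : exists (G : probability (borel K) R)
    (zeta : nat -> borel K -> borel K),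
  (forall i, measurable_fun setT (zeta i)) /\
  forall n A, (forall i, measurable (A i)) ->
    G (box_event zeta n A) = (\prod_(i < n) gamma (A i))%E.
Proof.
have [rd [T [Phi [[rd1 rdN rdE] rdT Phi1 PhiE]]]] := interleaving_maps.
have [G GE] := gaussian_probability hv hlambda1.
have mPhi := measurable_interleaving rdE rdT Phi1 PhiE.
pose Psi : borel K -> borel K := fun x => Phi (T x).
have mPsi : measurable_fun setT Psi := measurable_interleaving_odd rdE rdT Phi1 PhiE.
pose zeta i : borel K -> borel K := fun x => Phi (iter i Psi x).
have mzeta i : measurable_fun setT (zeta i).
  apply: measurableT_comp mPhi _; elim: i => [|i IH] /=; first exact: measurable_id.
  exact: measurableT_comp mPsi IH.
exists G, zeta; split => // n; elim: n => [|n IH] A mA.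
  rewrite big_ord0 (_ : box_event _ _ _ = setT) ?probability_setT//.
  by apply/seteqP; split.
rewrite big_ord_recl -(IH (fun i => A i.+1))// GE.
have -> : box_event zeta n.+1 A = (Phi : borel K -> borel K) @^-1` A 0%N `&`
    Psi @^-1` (box_event zeta n (fun i => A i.+1)).
  apply/seteqP; split => [x xA|x [xA0 xA] [|i] ilt].
  - split => [|i ilt]; first exact: xA.
    by have := xA i.+1 ilt; rewrite /zeta iterSr.
  - exact: xA0.
  - by have := xA i ilt; rewrite /zeta iterSr.
rewrite -GE; have mB := measurable_box_event n mzeta (fun i => mA i.+1).
have := interleaving_independent rd1 rdN rdE rdT Phi1 PhiE (G := G) GE (mA 0%N) mB.
by move=> H; apply: (etrans H); rewrite -[X in (_ * X)%E]GE.
Qed.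

End GaussianSequence.

(** * Shear-invariant laws on sequences *)

Section ShearInvariance.
Context {R : realType} {K : topologicalFieldType}.
Variables (v : K -> R) (q : nat).
Hypothesis hv : normalized_valuation v q.
Variable rho : K.
Hypothesis hrho : v rho = q%:R^-1.
Variable lambda : {measure set (borel K) -> \bar R}.
Hypothesis hlambda : haar_measure lambda.
Hypothesis hlambda1 : lambda (ring_of_integers v) = 1%E.

Local Notation vball := (vball v q).
Local Notation radius := (@radius R q).
Local Notation gamma := (gamma v lambda).
Local Notation M := (prod_space nat (borel K)).

Definition shear (i j : nat) (c : K) (x : M) : M :=
  fun k => if k == i then ((x i : K) + c * (x j : K) : K) else x k.

Lemma measurable_val_le d (T : measurableType d) (f : T -> borel K) k :
  measurable_fun setT f -> measurable [set w | v (f w) <= radius k].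
Proof.
by move=> mf; have := measurable_preimage_vball hv 0 k mf; rewrite vball0E.
Qed.

Lemma measurable_val_lt d (T : measurableType d) (f : T -> borel K) k :
  measurable_fun setT f -> measurable [set w | v (f w) < radius k].
Proof.
move=> mf; have := measurable_val_le (k + 1) mf; congr measurable.
by apply/funext => w /=; rewrite (val_lt_radius hv).
Qed.

Lemma measurable_val_eq d (T : measurableType d) (f : T -> borel K) k :
  measurable_fun setT f -> measurable [set w | v (f w) = radius k].
Proof.
move=> mf.
rewrite (_ : mkset _ = [set w | v (f w) <= radius k] `\` [set w | v (f w) < radius k]).
  by apply: measurableD; [exact: measurable_val_le|exact: measurable_val_lt].
apply/seteqP; split => w /= => [->|[le /negP]]; first by rewrite ltxx.
by rewrite -leNgt => ge; apply/le_anti; rewrite le ge.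
Qed.

Variable mu : {measure set M -> \bar R}.
Hypothesis mu1 : mu setT = 1%E.
Hypothesis mu_shear : forall i j c, i <> j -> v c <= 1 ->
  forall B, measurable B -> mu (shear i j c @^-1` B) = mu B.

Let mcoord i : measurable_fun setT (fun x : M => x i) := measurable_coord i.

Lemma mu_le1 B : measurable B -> (mu B <= 1)%E.
Proof. by move=> mB; rewrite -mu1 le_measure ?inE. Qed.

(** On an event where x_j is within q ^ (- m - k) of u, the shear with factor b / u
    adds b to x_i up to q ^ (- m - k). It therefore moves the coset of 0 to that of
    b, and all cosets of rho ^ (m + k) D in rho ^ m D are equally likely for x_i. *)
Lemma pivot_uniform i j (m : int) (k : nat) (u b : K) (B : set M) : i <> j ->
  measurable B -> avoids i B -> v u = radius m ->
  B `<=` [set x | vball u (m + k) (x j)] -> v b <= radius m ->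
  mu (B `&` (fun x : M => x i) @^-1` vball b (m + k)) =
  ((radius k)%:E * mu (B `&` (fun x : M => x i) @^-1` vball 0%R m))%E.
Proof.
move=> ij mB iB vu Bu vb.
apply: (@equal_cosets _ _ _ _ hv _ hrho _ _ mu B (fun x : M => x i) m k mB (mcoord i)) => // {vb}b vb.
have u0 : u != 0 by rewrite -(val_gt0 hv) vu (radius_gt0 hv).
have c1 : v (b / u) <= 1.
  by rewrite (valM hv) (valV hv) vu ler_pdivrMr ?(radius_gt0 hv)// mul1r.
rewrite -(mu_shear ij c1); last first.
  by apply: measurableI => //; exact: measurable_preimage_vball.
congr (mu _).
have shearB x : B (shear i j (b / u) x) <-> B x.
  by split; apply: iB => l /eqP li; rewrite /shear (negbTE li).
(* The translation c x_j is b up to the precision that is considered. *)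
have near x : B x -> v (b / u * (x j : K) - b) <= radius (m + k).
  move=> /Bu; rewrite /vball/= => xu.
  rewrite (_ : _ - _ = b / u * ((x j : K) - u)); last by rewrite mulrBr divfK.
  by rewrite (valM hv) (le_trans _ xu)// ler_piMl// (val_ge0 hv).
apply/seteqP; split => x [].
  move=> /shearB Bx; split => //; move: (near x Bx) => nx.
  move: b0; rewrite /preimage/vball/= /shear eqxx subr0 => xb.
  rewrite (_ : x i = ((x i : K) + b / u * (x j : K) - b) - (b / u * (x j : K) - b)).
    exact: (valB_le hv).
  by ring.
move=> Bx x0; split; first exact/shearB.
move: x0; rewrite /preimage/vball/= /shear eqxx subr0 => x0.
by rewrite -addrA; apply: (valD_le hv) => //; exact: near.
Qed.

(** The pivot index j and its approximate value u are removed by cutting B into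
    countably many pieces on which they are fixed; the pieces still avoid
    coordinate i. *)
Lemma tail_uniform i (m : int) (k : nat) (b : K) (B : set M) :
  measurable B -> avoids i B ->
  B `<=` [set x | exists j, j <> i /\ v (x j) = radius m] -> v b <= radius m ->
  mu (B `&` (fun x : M => x i) @^-1` vball b (m + k)) =
  ((radius k)%:E * mu (B `&` (fun x : M => x i) @^-1` vball 0%R m))%E.
Proof.
move=> mB iB Bj vb; have [s Hs] := dense_sequence hv hrho.
pose F n : set M := if choice.unpickle n is Some a then
  [set x | a.1 <> i /\ (v (s a.2) = radius m /\ vball (s a.2) (m + k) (x a.1))] else set0.
have mF n : measurable (F n).
  rewrite /F; case: choice.unpickle => [[j t]|]//=.
  by do 2!apply: measurable_and; exact: (measurable_preimage_vball hv _ _ (mcoord j)).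
have iF n : avoids i (F n).
  rewrite /F; case: choice.unpickle => [[j t]|]//= x y xy [ji [st]].
  by rewrite /= -xy.
have BF : B `<=` \bigcup_n F n.
  move=> x Bx; have [j [ji xm]] := Bj x Bx; have [t xt] := Hs (x j) (m + k.+1).
  (* One level of extra precision makes the approximation s t have the same size
     as x j, even for k = 0. *)
  exists (choice.pickle (j, t)) => //; rewrite /F choice.pickleK/=; split => //.
  split; last by apply: le_trans xt _; rewrite (le_radius hv) lerD2l lez_nat.
  rewrite -xm; apply: (val_eq_of_near hv); rewrite xm (le_lt_trans xt)//.
  by rewrite (lt_radius hv) ltrDl.
have mE c l : measurable ((fun x : M => x i) @^-1` vball c l).
  exact: (measurable_preimage_vball hv _ _ (mcoord i)).
apply: (measure_piecewise_scale (F := F)) => //.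
- by rewrite ltW// (radius_gt0 hv).
- exact: measurableI.
- exact: measurableI.
- by move=> x [/BF].
- by move=> x [/BF].
move=> n; rewrite (setIAC B ((fun x : M => x i) @^-1` vball b (m + k)) (seqDU F n)).
rewrite (setIAC B ((fun x : M => x i) @^-1` vball 0 m) (seqDU F n)).
have mBn : measurable (B `&` seqDU F n) by apply: measurableI => //; exact: seqDU_measurable.
have iBn : avoids i (B `&` seqDU F n) by apply: avoidsI => //; exact: avoids_seqDU.
have : B `&` seqDU F n `<=` F n by move=> x [_]; exact: subset_seqDU.
move: mBn iBn; set Bn := _ `&` _; clearbody Bn => mBn iBn; rewrite /F.
case: choice.unpickle => [[j t]/= BnF|]; last first.
  by rewrite subset0 => ->; rewrite !set0I !measure0 mule0.
have [[x /BnF[ji [st _]]]|Bn0] := pselect (Bn !=set0); last first.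
  have -> : Bn = set0 by apply/seteqP; split => // y By; apply: Bn0; exists y.
  by rewrite !set0I !measure0 mule0.
by apply: (pivot_uniform (j := j) _ mBn iBn st) => // [/esym //|y /BnF[_ []]].
Qed.

Lemma tail_gaussian i (m : int) (B : set M) (A : set (borel K)) :
  measurable B -> avoids i B ->
  B `<=` [set x | exists j, j <> i /\ v (x j) = radius m] -> measurable A ->
  mu (B `&` [set x | v (x i) <= radius m] `&`
      [set x | A (rho ^ (- m) * (x i : K) : K)]) =
  (gamma A * mu (B `&` [set x | v (x i) <= radius m]%R))%E.
Proof.
move=> mB iB Bj mA.
have mBi : measurable (B `&` [set x | v (x i) <= radius m]).
  by apply: measurableI => //; exact: measurable_val_le (mcoord i).
apply: (gaussian_of_vballs hv hrho hlambda hlambda1 mBi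
  (f := fun x : M => (rho ^ (- m) * (x i : K) : K) : borel K)) => //.
- by rewrite (le_lt_trans (mu_le1 mBi))// ltey.
- exact: (measurable_fun_borelZ hv hrho).
- move=> x [_ /= xm]; rewrite (valM hv) (val_rhoz hv hrho).
  by rewrite -radiusV ler_pdivrMl ?(radius_gt0 hv)// mulr1.
move=> b k b1; have vb : v (rho ^ m * b) <= radius m.
  by rewrite (valM hv) (val_rhoz hv hrho) ler_piMr// ltW// (radius_gt0 hv).
have e l : [set x : M | v (x i) <= radius l] = (fun x : M => x i) @^-1` vball 0 l.
  by rewrite vball0E.
rewrite [in RHS]e -(tail_uniform k mB iB Bj vb); congr (mu _).
have scale (x : M) : vball b k (rho ^ (- m) * (x i : K)) = vball (rho ^ m * b) (m + k) (x i).
  rewrite -[x i in RHS](mulVKf (rhoz_neq0 hv hrho m) (x i : K)) invr_expz.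
  have := scale_vball hv b k (val_rhoz hv hrho m).
  by move=> /(congr1 (fun A => A (rho ^ (- m) * (x i : K)))) /= ->.
apply/seteqP; split => x.
  by move=> [[Bx _]]; rewrite /preimage/= scale.
move=> [Bx xb]; split; last by rewrite /preimage/= scale.
split => //=; move: xb; rewrite /preimage/= => /(vball_le hv (l := m)).
rewrite lerDl => /(_ isT) xb; rewrite -(subrK (rho ^ m * b) (x i : K)).
exact: (valD_le hv).
Qed.

Definition late_small_upto (l L : nat) (m : int) : set M :=
  [set x | exists j, (j < l)%N /\ v (x j) = radius m /\
    forall i, (l <= i)%N -> (i < l + L)%N -> v (x i) < radius m].

Definition late_small (l : nat) (m : int) : set M :=
  [set x | exists j, (j < l)%N /\ v (x j) = radius m /\
    forall i, (l <= i)%N -> v (x i) < radius m].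

Definition unbounded : set M :=
  [set x | forall N : nat, exists i, radius (- N%:Z) <= v (x i)].

Lemma measurable_late_small_upto l L m : measurable (late_small_upto l L m).
Proof.
apply: measurable_exists => j; apply: measurable_and; apply: measurableI.
  exact: (measurable_val_eq _ (mcoord j)).
apply: measurable_forall => i; do 2!apply: measurable_imp.
exact: (measurable_val_lt _ (mcoord i)).
Qed.

Lemma measurable_late_small l m : measurable (late_small l m).
Proof.
apply: measurable_exists => j; apply: measurable_and; apply: measurableI.
  exact: (measurable_val_eq _ (mcoord j)).
apply: measurable_forall => i; apply: measurable_imp.
exact: (measurable_val_lt _ (mcoord i)).
Qed.

(** By [tail_uniform] with a pivot of index less than l, each of the coordinates
    l, ..., l + L - 1 is smaller than q ^ (- m) with conditional probability at most
    1/q, given the preceding ones. *)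
Lemma late_small_upto_le (l L : nat) (m : int) :
  (mu (late_small_upto l L m) <= (radius L)%:E)%E.
Proof.
pose V n := late_small_upto l n m.
have mV n : measurable (V n) by exact: measurable_late_small_upto.
rewrite -/(V L); elim: L => [|n IH]; first by rewrite radius0 mu_le1.
have -> : V n.+1 = V n `&` (fun x : M => x (l + n)%N) @^-1` vball 0 (m + 1%N).
  apply/seteqP; split => [x [j [jl [xj H]]]|x [[j [jl [xj H]]] xn]].
    split; last first.
      rewrite /preimage/vball/= subr0 -(val_lt_radius hv).
      by apply: H; rewrite ?leq_addr// addnS.
    by exists j; do 2!split => //; move=> i li iln; apply: H; rewrite // addnS leqW.
  exists j; do 2!split => //; move=> i li; rewrite addnS ltnS leq_eqVlt => /orP[/eqP ->|].
    by move: xn; rewrite /preimage/vball/= subr0 -(val_lt_radius hv).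
  exact: H.
rewrite tail_uniform//.
- rewrite (_ : radius n.+1 = radius 1%N * radius n); last first.
    by rewrite -(radiusD hv) -PoszD add1n.
  rewrite EFinM lee_wpmul2l//.
    by rewrite lee_fin ltW// (radius_gt0 hv).
  apply: le_trans IH; apply: le_measure; rewrite ?inE//.
  by apply: measurableI => //; exact: (measurable_preimage_vball hv _ _ (mcoord _)).
- move=> x y xy [j [jl [xj H]]]; exists j; split => //; split.
    by rewrite -xy// => e; move: jl; rewrite e ltnNge leq_addr.
  move=> i li iln; rewrite -xy; first exact: H.
  by move=> e; move: iln; rewrite e ltnn.
- move=> x [j [jl [xj H]]]; exists j; split => // e.
  by move: jl; rewrite e ltnNge leq_addr.
- by rewrite (val0 hv) ltW// (radius_gt0 hv).
Qed.

Lemma late_small_null (l : nat) (m : int) : mu (late_small l m) = 0%E.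
Proof.
apply/eqP; rewrite -measure_le0; apply/lee_addgt0Pr => e e0; rewrite add0e.
have [L Le] := exists_radius_lt hv e0.
apply: le_trans (_ : (radius L)%:E <= _)%E; last by rewrite lee_fin ltW.
apply: le_trans (late_small_upto_le l L m); apply: le_measure; rewrite ?inE//.
- exact: measurable_late_small.
- exact: measurable_late_small_upto.
- by move=> x [j [jl [xj H]]]; exists j; do 2!split => //; move=> i li _; exact: H.
Qed.

Lemma measurable_unbounded : measurable unbounded.
Proof.
apply: measurable_forall => N; apply: measurable_exists => i.
have := measurableC (measurable_val_lt (- N%:Z) (mcoord i)); congr measurable.
by apply/funext => x /=; rewrite leNgt; apply/propext; split => /negP.
Qed.

(** Unboundedness avoids coordinate 0. On it, for each N, some coordinate other
    than the one of index 0 has size q ^ n with n >= N; taking it as a pivot, |x_0| <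
    q ^ n has conditional probability at most 1/q. Hence P (unbounded, |x_0| < q ^ N)
    <= P (unbounded) / q for each N, and the left-hand side tends to
    P (unbounded). *)
Lemma unbounded_null : mu unbounded = 0%E.
Proof.
pose Unb := unbounded; rewrite -/Unb.
have mUnb : measurable Unb := measurable_unbounded.
pose S (N : nat) : set M := [set x | v (x 0%N) < radius (- N%:Z)].
have mS N : measurable (S N) by exact: (measurable_val_lt _ (mcoord 0%N)).
have large x N : Unb x -> exists j, j <> 0%N /\ exists n : nat,
    (N <= n)%N /\ v (x j) = radius (- n%:Z).
  move=> Ux; have [a xa] : exists a : nat, v (x 0%N) < radius (- a%:Z).
    have [->|[m ->]] := val_spec hv (x 0%N); first by exists 0%N; rewrite (radius_gt0 hv).
    by exists `|m|.+1%N; rewrite (lt_radius hv); lia.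
  have [j xj] := Ux (maxn a N); exists j; split.
    move=> j0; move: xj; rewrite j0 leNgt (lt_le_trans xa)//.
    by rewrite (le_radius hv) lerN2 lez_nat leq_maxl.
  have [xj0|[m xm]] := val_spec hv (x j).
    by move: xj; rewrite xj0 leNgt (radius_gt0 hv).
  move: xj; rewrite xm (le_radius hv) lerNr => Nm.
  by exists `|m|%N; split; [lia|congr radius; lia].
have iUnb : avoids 0%N Unb.
  move=> x y xy Ux N; have [j [j0 [n [Nn xn]]]] := large x N Ux.
  by exists j; rewrite -xy// xn (le_radius hv) lerN2 lez_nat.
have main N : (mu (Unb `&` S N) <= (radius 1)%:E * mu Unb)%E.
  pose F (n : nat) : set M := [set x | exists j, j <> 0%N /\ v (x j) = radius (- (N + n)%N%:Z)].
  have mF n : measurable (F n).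
    by apply: measurable_exists => j; apply: measurable_and; exact: (measurable_val_eq _ (mcoord j)).
  have iF n : avoids 0%N (F n).
    by move=> x y xy [j [j0 xj]]; exists j; split => //; rewrite -xy.
  have UF : Unb `<=` \bigcup_n F n.
    move=> x /(large x N)[j [j0 [n [Nn xn]]]]; exists (n - N)%N => //.
    by exists j; split => //; rewrite subnKC.
  apply: (measure_piecewise_le (F := F)) => //.
  - by rewrite ltW// (radius_gt0 hv).
  - exact: measurableI.
  - by move=> x [/UF].
  move=> n; rewrite setIAC.
  have mUn : measurable (Unb `&` seqDU F n).
    by apply: measurableI => //; exact: seqDU_measurable.
  have iUn : avoids 0%N (Unb `&` seqDU F n) by apply: avoidsI => //; exact: avoids_seqDU.
  have UnF : Unb `&` seqDU F n `<=` F n by move=> x [_]; exact: subset_seqDU.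
  have := tail_uniform 1%N mUn iUn UnF (b := 0).
  rewrite (val0 hv) => /(_ (ltW (radius_gt0 hv _))) e.
  apply: (@le_trans _ _ ((radius 1)%:E * mu (Unb `&` seqDU F n `&`
     (fun x : M => x 0%N) @^-1` vball 0%R (- (N + n)%N%:Z)%R))%E).
    rewrite -e; apply: le_measure; rewrite ?inE//.
    + exact: measurableI.
    + by apply: measurableI => //; exact: (measurable_preimage_vball hv _ _ (mcoord _)).
    + apply: setIS => x /= xN; rewrite /preimage/vball/= subr0 -(val_lt_radius hv).
      by rewrite (lt_le_trans xN)// (le_radius hv) lerN2 lez_nat leq_addr.
  rewrite lee_wpmul2l//; first by rewrite lee_fin ltW// (radius_gt0 hv).
  apply: le_measure; rewrite ?inE//.
  by apply: measurableI => //; exact: (measurable_preimage_vball hv _ _ (mcoord _)).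
have lim : (mu Unb <= (radius 1)%:E * mu Unb)%E.
  have cvg : mu \o (fun N => Unb `&` S N) @ \oo --> mu (\bigcup_N (Unb `&` S N)).
    apply: nondecreasing_cvg_mu.
    - by move=> N; exact: measurableI.
    - by apply: bigcupT_measurable => N; exact: measurableI.
    - move=> a b ab; apply/subsetPset; apply: setIS => x; rewrite /S/= => xa.
      by rewrite (lt_le_trans xa)// (le_radius hv) lerN2 lez_nat.
  have UE : \bigcup_N (Unb `&` S N) = Unb.
    apply/seteqP; split => [x [N _ []]//|x Ux].
    have [xz|[m xm]] := val_spec hv (x 0%N).
      by exists 0%N => //; split => //=; rewrite /S/= xz (radius_gt0 hv).
    exists `|m|.+1%N => //; split => //=; rewrite /S/= xm (lt_radius hv).
    by lia.
  rewrite UE in cvg; rewrite -[leLHS](cvg_lim _ cvg)//; apply: lime_le; first by apply/cvg_ex; eexists; exact: cvg.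
  by apply: nearW => N /=; exact: main.
have Ufin : mu Unb = (fine (mu Unb))%:E.
  by rewrite fineK// ge0_fin_numE// (le_lt_trans (mu_le1 mUnb))// ltey.
move: lim; rewrite Ufin -EFinM lee_fin => lim; congr (_%:E); apply/le_anti.
rewrite fine_ge0// andbT leNgt; apply/negP => U0; move: lim.
by rewrite leNgt gtr_pMl// -(@radius0 R q) (lt_radius hv).
Qed.

(** As the valuation is discrete, a positive finite supremum is attained; so this is
    the event that the supremum is q ^ (- m). *)
Definition sup_val_is (m : int) : set M :=
  [set x | (forall i, v (x i) <= radius m) /\ exists j, v (x j) = radius m].

Lemma measurable_sup_val_is m : measurable (sup_val_is m).
Proof.
apply: measurableI.
  by apply: measurable_forall => i; exact: (measurable_val_le _ (mcoord i)).
by apply: measurable_exists => i; exact: (measurable_val_eq _ (mcoord i)).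
Qed.

(** Up to a null event the supremum is attained at some index j >= n. With that
    coordinate as a pivot, the first n scaled coordinates are added one at a time
    by [tail_gaussian]. *)
Lemma scaled_coordinates_gaussian (m : int) n (A : nat -> set (borel K)) :
  (forall i, measurable (A i)) ->
  mu (sup_val_is m `&` box_event (fun i (x : M) => rho ^ (- m) * (x i : K) : borel K) n A) =
  ((\prod_(i < n) gamma (A i)) * mu (sup_val_is m))%E.
Proof.
move=> mA.
(* Tn is the analogue of [sup_val_is m] for the coordinates from n on, Y t
   prescribes the first t scaled coordinates, and Z i0 bounds the first n ones
   except the one of index i0; Z n has no exception. *)
pose Tn : set M := [set x | (forall i, (n <= i)%N -> v (x i) <= radius m) /\
  exists j, (n <= j)%N /\ v (x j) = radius m].
have mTn : measurable Tn.
  apply: measurableI.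
    apply: measurable_forall => i; apply: measurable_imp.
    exact: (measurable_val_le _ (mcoord i)).
  apply: measurable_exists => j; apply: measurable_and.
  exact: (measurable_val_eq _ (mcoord j)).
pose Y t : set M := [set x | forall i, (i < t)%N -> A i (rho ^ (- m) * (x i : K) : K)].
have mY t : measurable (Y t).
  apply: (measurable_box_event (X := fun i (x : M) => rho ^ (- m) * (x i : K) : borel K)) => // i.
  exact: (measurable_fun_borelZ hv hrho).
pose Z (i0 : nat) : set M := [set x | forall i, (i < n)%N -> i <> i0 -> v (x i) <= radius m].
have mZ i0 : measurable (Z i0).
  apply: measurable_forall => i; do 2!apply: measurable_imp.
  exact: (measurable_val_le _ (mcoord i)).
have small_null t : mu (sup_val_is m `&` Y t) = mu (Tn `&` Z n `&` Y t).
  apply/eqP; rewrite eq_le; apply/andP; split; last first.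
    apply: le_measure; rewrite ?inE//.
    - by do 2!apply: measurableI => //.
    - by apply: measurableI => //; exact: measurable_sup_val_is.
    - apply: setSI => x [[xn [j [nj xj]]] xZ]; split; last by exists j.
      move=> i; have [ni|ni] := leqP n i; first exact: xn.
      by apply: xZ => // e; move: ni; rewrite e ltnn.
  pose N := late_small n m.
  have mN : measurable N by exact: measurable_late_small.
  apply: (@le_trans _ _ (mu ((Tn `&` Z n `&` Y t) `|` N))); last first.
    apply: le_trans (measureU2 _ _ _) _ => //; first by do 2!apply: measurableI => //.
    by rewrite [X in (_ + X)%E](late_small_null n m) adde0.
  apply: le_measure; rewrite ?inE//.
  - by apply: measurableI => //; exact: measurable_sup_val_is.
  - by apply: measurableU => //; do 2!apply: measurableI => //.
  - move=> x [[xm [j xj]] Yx].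
    have [[k [nk xk]]|nex] := pselect (exists k, (n <= k)%N /\ v (x k) = radius m).
      left; split => //; split; first by split; [move=> i _; exact: xm|exists k].
      by move=> i _ _; exact: xm.
    right; exists j; split; last split => //.
      by rewrite ltnNge; apply/negP => nj; apply: nex; exists j.
    move=> i ni; rewrite lt_neqAle xm andbT; apply/eqP => xi.
    by apply: nex; exists i.
have Yt t : (t <= n)%N -> mu (Tn `&` Z n `&` Y t) =
    ((\prod_(i < t) gamma (A i)) * mu (Tn `&` Z n))%E.
  elim: t => [_|t IH tn].
    rewrite big_ord0 mul1e; congr (mu _).
    by apply/seteqP; split => [x []|x xT]//; split.
  rewrite big_ord_recr/= [X in (X * _)%E]muleC -muleA -IH; last exact: ltnW.
  have := @tail_gaussian t m (Tn `&` Z t `&` Y t) (A t).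
  have e : Tn `&` Z n `&` Y t = Tn `&` Z t `&` Y t `&` [set x | v (x t) <= radius m].
    apply/seteqP; split => [x [[xT xZ] xY]|x [[[xT xZ] xY] xt]].
      split; last by apply: xZ => // e; move: tn; rewrite e ltnn.
      by split => //; split => // i ilt _; apply: xZ => // e; move: ilt; rewrite e ltnn.
    split => //; split => // i ilt _.
    by have [->//|/eqP it] := eqVneq i t; apply: xZ.
  rewrite -e => <- //.
  - congr (mu _); apply/seteqP; split => [x [xTZ xY]|x [[xTZ xY] xt]].
      by split; [split => // i ilt; apply: xY; exact: leqW|exact: xY].
    split => // i; rewrite ltnS leq_eqVlt => /orP[/eqP ->//|]; exact: xY.
  - by do 2!apply: measurableI => //.
  - have ne i : (n <= i)%N -> i <> t by move=> ni it; move: tn; rewrite ltnNge -it ni.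
    move=> x y xy [[[xn [j [nj xj]]] xZ] xY]; split; first split; first split.
    + by move=> i ni; rewrite -xy; [exact: xn|exact: ne].
    + by exists j; rewrite -xy; [split|exact: ne].
    + by move=> i ilt it; rewrite -xy//; exact: xZ.
    + move=> i ilt /=; rewrite -xy; first exact: xY.
      by move=> it; move: ilt; rewrite it ltnn.
  - move=> x [[[_ [j [nj xj]]] _] _]; exists j; split => // e'.
    by move: tn; rewrite ltnNge -e' nj.
rewrite -/(Y n) small_null Yt//; congr (_ * _)%E.
have e0 : Tn `&` Z n `&` Y 0%N = Tn `&` Z n.
  by apply/seteqP; split => [x []|x xT]//; split.
rewrite -e0 -small_null; congr (mu _).
by apply/seteqP; split => [x []|x xT]//; split.
Qed.

End ShearInvariance.

(** * Integral matrices and rotatable laws *)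

Section IntegralMatrices.
Context {R : realType} {K : topologicalFieldType}.
Variables (v : K -> R) (q : nat).
Hypothesis hv : normalized_valuation v q.

Lemma val_det_le1 n (A : 'M[K]_n) : (forall i j, v (A i j) <= 1) -> v (\det A) <= 1.
Proof.
move=> A1; rewrite /determinant; apply: (val_sum_le hv) => // s _.
rewrite (valM hv) -[X in _ <= X]mulr1 ler_pM ?(val_ge0 hv)//.
  by case: (perm.odd_perm s); rewrite ?expr0 ?expr1 ?(valN hv) (val1 hv).
elim/big_ind : _ => //; first by rewrite (val1 hv).
by move=> x y x1 y1; rewrite (valM hv) mulr_ile1// (val_ge0 hv).
Qed.

Lemma GL_integers_unitmx n (U : 'M[K]_n) : GL_integers v U -> U \in unitmx.
Proof.
move=> [_ U1]; rewrite unitmxE unitfE -(val_gt0 hv) U1; exact: ltr01.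
Qed.

(** The inverse is the adjugate divided by a determinant of valuation 1. *)
Lemma GL_integers_invmx n (U : 'M[K]_n) i j : GL_integers v U -> v (invmx U i j) <= 1.
Proof.
move=> GU; have [U1 dU] := GU; rewrite /invmx (GL_integers_unitmx GU).
rewrite mxE (valM hv) (valV hv) dU invr1 mul1r mxE /cofactor (valM hv).
rewrite -[X in _ <= X]mulr1 ler_pM ?(val_ge0 hv)//.
  by rewrite -signr_odd; case: odd; rewrite ?expr0 ?expr1 ?(valN hv) (val1 hv).
by apply: val_det_le1 => k l; rewrite !mxE; exact: U1.
Qed.

Lemma integral_mulmx_le m n (A : 'M[K]_(m, n)) (x : 'cV[K]_n) (e : R) :
  0 <= e -> (forall i j, v (A i j) <= 1) -> (forall j, v (x j 0) <= e) ->
  forall i, v ((A *m x) i 0) <= e.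
Proof.
move=> e0 A1 xe i; rewrite mxE; apply: (val_sum_le hv) => // j _.
by rewrite (valM hv) (le_trans _ (xe j))// ler_piMl// (val_ge0 hv).
Qed.

Definition shear_mx n (i j : 'I_n) (c : K) : 'M[K]_n := 1%:M + c *: delta_mx i j.

Lemma shear_mxE n (i j : 'I_n) (c : K) (x : 'cV[K]_n) k :
  (shear_mx i j c *m x) k 0 = x k 0 + (if k == i then c * x j 0 else 0).
Proof.
rewrite /shear_mx mulmxDl mul1mx mxE -scalemxAl; congr (_ + _).
rewrite mxE mxE (bigD1 j)//= big1 ?addr0.
  by rewrite mxE eqxx andbT; case: eqP; rewrite ?mul1r ?mul0r ?mulr0.
by move=> l lj; rewrite mxE (negbTE lj) andbF mul0r.
Qed.

(** The determinants of a shear and of its inverse are integral with product 1. *)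
Lemma shear_mx_GL n (i j : 'I_n) (c : K) : i != j -> v c <= 1 ->
  GL_integers v (shear_mx i j c).
Proof.
move=> ij c1.
have entries d : v d <= 1 -> forall k l, v (shear_mx i j d k l) <= 1.
  move=> d1 k l; rewrite !mxE; apply: (valD_le hv).
    by case: eqP => _; rewrite ?(val1 hv) ?(val0 hv).
  by case: andP => _; rewrite ?mulr1 ?mulr0 ?(val0 hv).
have inv : shear_mx i j c *m shear_mx i j (- c) = 1%:M.
  rewrite /shear_mx mulmxDl mul1mx mulmxDr mulmx1 -scalemxAl -scalemxAr.
  by rewrite mul_delta_mx_0 1?eq_sym// !scaler0 addr0 scaleNr addrNK.
split; first exact: entries.
have vd := val_det_le1 (entries c c1).
have vd' : v (\det (shear_mx i j (- c))) <= 1 by apply/val_det_le1/entries; rewrite (valN hv).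
have := congr1 (fun A => v (\det A)) inv; rewrite det_mulmx det1 (val1 hv) (valM hv) => dd.
apply/le_anti; by rewrite vd/= -[X in X <= _]dd ler_piMr// (val_ge0 hv).
Qed.

Definition mul_column n (U : 'M[K]_n) (f : nat -> K) : prod_space 'I_n (borel K) :=
  fun i => (U *m \col_(j < n) f j) i 0.

Lemma mul_column_scale n (U : 'M[K]_n) t (f : nat -> K) :
  mul_column U (fun i => t * f i) = fun i => t * mul_column U f i.
Proof.
apply/funext => i; rewrite /mul_column.
have -> : \col_(j < n) (t * f j) = t *: \col_(j < n) f j.
  by apply/matrixP => j k; rewrite !mxE.
by rewrite -scalemxAr mxE.
Qed.

Lemma mul_column1 n (f : nat -> K) : mul_column 1%:M f = (fun i : 'I_n => f i).
Proof. by apply/funext => i; rewrite /mul_column mul1mx mxE. Qed.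

End IntegralMatrices.

Section Rotations.
Context {R : realType} {K : topologicalFieldType}.
Variables (v : K -> R) (q : nat).
Hypothesis hv : normalized_valuation v q.
Variable rho : K.
Hypothesis hrho : v rho = q%:R^-1.
Context d (T : measurableType d) (P : probability T R).

Lemma measurable_mul_column d1 (W : measurableType d1) n (U : 'M[K]_n)
    (f : nat -> W -> borel K) : (forall i, measurable_fun setT (f i)) ->
  measurable_fun setT (fun w => mul_column U (fun i => f i w)).
Proof.
move=> mf; apply: measurable_fun_prod_space => k; rewrite /mul_column.
under eq_fun do rewrite mxE.
under eq_fun do under eq_bigr do rewrite mxE.
exact: (measurable_fun_borel_sum hv hrho).
Qed.

Lemma measurable_shear i j c :
  measurable_fun setT (shear i j c : prod_space nat (borel K) -> prod_space nat (borel K)).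
Proof.
apply: measurable_fun_prod_space => k; rewrite /shear.
case: eqP => _; last exact: measurable_coord.
apply: (measurable_fun_borelD hv hrho); first exact: measurable_coord.
by apply: (measurable_fun_borelZ hv hrho); exact: measurable_coord.
Qed.

(** Rotatability only concerns finitely many coordinates; the law of the whole
    sequence inherits invariance under shears, since boxes determine it. *)
Lemma rotatable_law (xi : nat -> {RV P >-> borel K}) : rotatable P v xi ->
  exists mu : {measure set (prod_space nat (borel K)) -> \bar R},
  [/\ forall B, mu B = P ((fun w k => xi k w) @^-1` B), mu setT = 1%E &
      forall i j c, i <> j -> v c <= 1 ->
      forall B, measurable B -> mu (shear i j c @^-1` B) = mu B].
Proof.
move=> rot.
pose X : T -> prod_space nat (borel K) := fun w k => xi k w.
have mX : measurable_fun setT X.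
  by apply: measurable_fun_prod_space => k; exact: measurable_funP.
have [m2 Hm2] := image_restriction_measure P measurableT mX.
exists m2; split.
- by move=> B; rewrite Hm2 setTI.
- by rewrite Hm2 setTI preimage_setT; exact: probability_setT.
move=> i j c ij c1 B mB.
have mSX : measurable_fun setT (shear i j c \o X).
  exact: measurableT_comp (measurable_shear i j c) mX.
have [m1 Hm1] := image_restriction_measure P measurableT mSX.
have -> : m2 (shear i j c @^-1` B) = m1 B by rewrite Hm1 Hm2.
move: B mB; apply: sequence_measure_unique.
  have -> : m1 setT = 1%E by rewrite Hm1 setTI preimage_setT; exact: probability_setT.
  by rewrite ltey.
move=> n A mA; rewrite Hm1 Hm2 !setTI.
(* A common size at which both the box and the shear are finite-dimensional. *)
pose N := (n + i + j).+1.
have iN : (i < N)%N by rewrite ltnS addnAC leq_addl.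
have jN : (j < N)%N by rewrite ltnS leq_addl.
pose C : set (prod_space 'I_N (borel K)) :=
  [set y | forall k : 'I_N, (k < n)%N -> A k (y k)].
have mC : measurable C.
  apply: measurable_ord_forall => k; apply: measurable_imp.
  by rewrite -[X in measurable X]setTI; exact: measurable_coord.
have GLU : GL_integers v (shear_mx (Ordinal iN) (Ordinal jN) c).
  by apply: (shear_mx_GL hv) => //; apply/eqP => /(congr1 val).
have := rot N isT _ GLU C mC; rewrite /pushforward => H.
have CE (y : 'I_N -> borel K) (x : prod_space nat (borel K)) :
    (forall k : 'I_N, y k = x k) -> C y <-> box_event (@coord _ (borel K)) n A x.
  move=> yx; split => Cy => [k kn|k kn]; last by rewrite yx; exact: Cy.
  have kN : (k < N)%N by rewrite (leq_trans kn)// /N -addnA leqW// leq_addr.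
  by have := Cy (Ordinal kN) kn; rewrite yx.
transitivity (P ((fun w (k : 'I_N) =>
    (shear_mx (Ordinal iN) (Ordinal jN) c *m \col_(j < N) (xi j w : K)) k 0) @^-1` C)).
  congr (P _); apply/funext => w; apply: propext; apply: iff_sym; apply: CE => k.
  rewrite shear_mxE !mxE /= /shear /X -val_eqE /=.
  by case: eqP => [->|_]//; rewrite addr0.
by rewrite H; congr (P _); apply/funext => w; apply: propext; exact: CE.
Qed.

End Rotations.

(** * Invariance of Gaussian vectors *)

Section GaussianRotation.
Context {R : realType} {K : topologicalFieldType}.
Variables (v : K -> R) (q : nat).
Hypothesis hv : normalized_valuation v q.
Variable rho : K.
Hypothesis hrho : v rho = q%:R^-1.
Variable lambda : {measure set (borel K) -> \bar R}.
Hypothesis hlambda : haar_measure lambda.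
Hypothesis hlambda1 : lambda (ring_of_integers v) = 1%E.

Local Notation vball := (vball v q).
Local Notation radius := (@radius R q).
Local Notation gamma := (gamma v lambda).

Definition polyball n (a : 'I_n -> K) (l : nat) : set (prod_space 'I_n (borel K)) :=
  [set y | forall k, vball (a k) l (y k)].

(** Polyballs whose factors have a common level: unlike boxes with arbitrary
    factors, these are permuted by integral isometries. The full space is added so
    that the family contains a cover of itself. *)
Definition polyballs n : set (set (prod_space 'I_n (borel K))) :=
  [set C | C = set0 \/ C = setT \/ exists a (l : nat), C = polyball a l].

Lemma measurable_polyball n (a : 'I_n -> K) l : measurable (polyball a l).
Proof.
apply: measurable_ord_forall => k.
exact: (measurable_preimage_vball hv (a k) l (@measurable_coord _ _ (borel K) k)).
Qed.

Lemma polyballs_setI n : setI_closed (@polyballs n).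
Proof.
move=> B C [->|[->|[a [l ->]]]] [->|[->|[b [m ->]]]];
  rewrite ?set0I ?setI0 ?setTI ?setIT; do ?by left.
- by right; left.
- by right; right; exists b, m.
- by right; right; exists a, l.
have [->|/set0P[x [xa xb]]] := eqVneq (polyball a l `&` polyball b m) set0; first by left.
right; right; exists x, (maxn l m); apply/seteqP; split => y.
  move=> [ya yb] k; rewrite /vball/=.
  have := ya k; rewrite -(vball_eq hv (xa k)) => yal.
  have := yb k; rewrite -(vball_eq hv (xb k)) => ybm.
  by case: (leqP l m).
move=> yx; split => k.
  rewrite -(vball_eq hv (xa k)); apply: vball_le (yx k) => //.
  by rewrite lez_nat leq_maxl.
rewrite -(vball_eq hv (xb k)); apply: vball_le (yx k) => //.
by rewrite lez_nat leq_maxr.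
Qed.

(** A cylinder over a ball is a countable union of polyballs of its level, the
    other centres running over a dense sequence. *)
Lemma polyballs_generate n :
  measurable = <<s @polyballs n >> :> set (set (prod_space 'I_n (borel K))).
Proof.
apply/seteqP; split; apply: smallest_sub; [exact: smallest_sigma_algebra| |
    exact: sigma_algebra_measurable|]; last first.
  move=> _ [->|[->|[a [l ->]]]]; [exact: measurable0|exact: measurableT|].
  exact: measurable_polyball.
have [s Hs] := dense_sequence hv hrho.
move=> _ [i _ [A mA <-]].
pose T := g_sigma_algebraType (@polyballs n).
suff mi : measurable_fun setT (fun x : T => x i : borel K) by exact: mi measurableT _ mA.
apply: (measurable_fun_borel hv hrho) => b k.
pose a (t : {ffun 'I_n -> nat}) j := if j == i then b else s (t j).
rewrite (_ : _ @^-1` _ = \bigcup_t polyball (a t) k).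
  apply: countable_bigcupT_measurable; first exact: countableP.
  by move=> t; apply: sub_sigma_algebra; right; right; exists (a t), k.
apply/seteqP; split => [x xb|x [t _ /(_ i)]]; last by rewrite /a eqxx.
have [t Ht] := choice (fun j => Hs (x j) k).
exists [ffun j => t j] => // j; rewrite /a ffunE; case: eqP => [->|_]; first exact: xb.
exact: Ht.
Qed.

Context d (T : measurableType d) (P : probability T R).
Variable eta : nat -> {RV P >-> borel K}.
Hypothesis eta_box : forall n A, (forall i, measurable (A i)) ->
  P (box_event eta n A) = (\prod_(i < n) gamma (A i))%E.

Lemma gaussian_polyball n (a : 'I_n -> K) (l : nat) :
  P ((fun w (i : 'I_n) => eta i w) @^-1` polyball a l) =
  (\prod_(k < n) gamma (vball (a k) l))%E.
Proof.
pose A i : set (borel K) := oapp (fun k : 'I_n => vball (a k) l) setT (insub i).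
have mA i : measurable (A i).
  by rewrite /A; case: insub => [k|] //=; exact: measurable_vball.
transitivity (P (box_event eta n A)); last first.
  by rewrite eta_box//; apply: eq_bigr => k _; rewrite /A valK.
congr (P _); apply/seteqP; split => w /= H.
  by move=> i ilt; have := H (Ordinal ilt); rewrite /A insubT.
by move=> k; have := H k (ltn_ord k); rewrite /A valK.
Qed.

(** If b is integral then so is a = U b, and conversely; so both polyballs lie in
    D ^ n and have equal masses, or both are null. *)
Lemma prod_gamma_polyball n (U : 'M[K]_n) (a b : 'I_n -> K) (l : nat) :
  GL_integers v U -> (\col_i a i) = U *m (\col_i b i) ->
  (\prod_(k < n) gamma (vball (a k) l))%E = (\prod_(k < n) gamma (vball (b k) l))%E.
Proof.
move=> GU ab; have ba : (\col_i b i) = invmx U *m (\col_i a i).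
  by rewrite ab mulKmx// (GL_integers_unitmx hv).
have [/forallP a1|] := boolP [forall k, v (a k) <= 1].
  have b1 k : v (b k) <= 1.
    have := @integral_mulmx_le _ _ _ _ hv _ _ (invmx U) (\col_i a i) 1 ler01 _ _ k.
    rewrite -ba mxE; apply => [i j|j]; first exact: GL_integers_invmx hv _ _ _ _ GU.
    by rewrite mxE.
  by apply: eq_bigr => k _; rewrite !(gamma_vball hv hrho hlambda hlambda1).
rewrite negb_forall => /existsP[k]; rewrite -ltNge => ak.
have [/forallP b1|] := boolP [forall k, v (b k) <= 1].
  have : v ((U *m \col_i b i) k 0) <= 1.
    by apply: (integral_mulmx_le hv ler01 GU.1) => j; rewrite mxE.
  by rewrite -ab mxE leNgt ak.
rewrite negb_forall => /existsP[k']; rewrite -ltNge => bk.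
by rewrite (prode_eq0 (k := k)) ?(prode_eq0 (k := k'))// (gamma_vball0 hv).
Qed.

Lemma gaussian_rotation n (U : 'M[K]_n) (C : set (prod_space 'I_n (borel K))) :
  GL_integers v U -> measurable C ->
  P ((fun w (i : 'I_n) => (U *m \col_(j < n) (eta j w : K)) i 0) @^-1` C) =
  P ((fun w (i : 'I_n) => eta i w) @^-1` C).
Proof.
move=> GU; pose X : T -> prod_space 'I_n (borel K) := fun w i => eta i w.
pose Y : T -> prod_space 'I_n (borel K) :=
  fun w i => (U *m \col_(j < n) (eta j w : K)) i 0.
have mX : measurable_fun setT X.
  by apply: measurable_fun_prod_space => k; exact: measurable_funP.
have mY : measurable_fun setT Y.
  by apply: (measurable_mul_column hv hrho U (f := eta)) => k; exact: measurable_funP.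
have [m1 Hm1] := image_restriction_measure P measurableT mX.
have [m2 Hm2] := image_restriction_measure P measurableT mY.
suff H : forall C, measurable C -> m2 C = m1 C.
  by move=> /H; rewrite Hm1 Hm2 !setTI.
have PT : P setT = 1%E by exact: probability_setT.
apply: (measure_unique (@polyballs n) (fun=> setT)).
- exact: polyballs_generate.
- exact: polyballs_setI.
- by move=> _; right; left.
- by apply/seteqP; split => // x _; exists 0%N.
- move=> _ [->|[->|[a [l ->]]]]; first by rewrite !measure0.
    by rewrite Hm1 Hm2 !setTI !preimage_setT.
  have HX c : m1 (polyball c l) = (\prod_(k < n) gamma (vball (c k) l))%E.
    by rewrite Hm1 setTI; exact: gaussian_polyball.
  pose b k := (invmx U *m \col_i a i) k 0.
  have ab : (\col_i a i) = U *m (\col_i b i).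
    have -> : (\col_i b i) = invmx U *m \col_i a i.
      by apply/matrixP => i j; rewrite mxE ord1.
    by rewrite mulKVmx// (GL_integers_unitmx hv).
  rewrite HX (prod_gamma_polyball l GU ab) -HX Hm1 Hm2 !setTI.
  have r0 : 0 <= radius l by rewrite ltW// (radius_gt0 hv).
  have colB (c : 'I_n -> K) w k :
      (\col_(j < n) (c j) - \col_(j < n) (eta j w : K)) k 0 = c k - (eta k w : K).
    by rewrite !mxE.
  congr (P _); apply/seteqP; split => w H k; rewrite /vball/= (valC hv).
    rewrite -(colB b w) -[\col_j (b j) - _](mulKmx (GL_integers_unitmx hv GU)).
    apply: (integral_mulmx_le hv r0) => [i j|j].
      exact: (GL_integers_invmx hv _ _ GU).
    by rewrite mulmxBr -ab mxE [X in v (X + _)]mxE mxE (valC hv); exact: H.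
  have -> : a k - Y w k = (U *m (\col_(j < n) (b j) - \col_(j < n) (eta j w : K))) k 0.
    by rewrite mulmxBr -ab mxE [X in _ = X + _]mxE mxE.
  apply: (integral_mulmx_le hv r0 GU.1) => j.
  by rewrite colB (valC hv); exact: H.
- move=> _; have -> : m2 setT = 1%E by rewrite Hm2 setTI preimage_setT; exact: PT.
  by rewrite ltey.
Qed.

End GaussianRotation.

(** * The supremum and its scaling factor *)

Section Tau.
Context {R : realType} {K : topologicalFieldType}.
Variables (v : K -> R) (q : nat).
Hypothesis hv : normalized_valuation v q.
Variable rho : K.
Hypothesis hrho : v rho = q%:R^-1.
Context d (Omega : measurableType d) (P : probability Omega R).
Variable xi : nat -> {RV P >-> borel K}.

Local Notation radius := (@radius R q).
Local Notation M := (prod_space nat (borel K)).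

Lemma sup_val_isP w m : sup_val v xi w = (radius m)%:E <-> sup_val_is v q m (xi^~ w).
Proof.
split => [sE|[le [j xj]]]; last first.
  apply/le_anti/andP; split.
    by apply: ge_ereal_sup => _ [i _ <-]; rewrite lee_fin le.
  by apply: ereal_sup_ubound; exists j => //; rewrite xj.
have le i : v (xi i w) <= radius m.
  by rewrite -lee_fin -sE; apply: ereal_sup_ubound; exists i.
split => //; apply: contrapT => nex.
have : (sup_val v xi w <= (radius (m + 1))%:E)%E.
  apply: ge_ereal_sup => _ [i _ <-]; rewrite lee_fin -(val_lt_radius hv) lt_neqAle le andbT.
  by apply/eqP => xm; apply: nex; exists i.
by rewrite sE lee_fin (le_radius hv); lia.
Qed.

Lemma sup_val_is_inj x m n : sup_val_is v q m x -> sup_val_is v q n x -> m = n.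
Proof.
move=> [lem [i xi_m]] [len [j xj_n]]; apply: (radius_inj hv); apply/le_anti.
by rewrite -{1}xi_m len -xj_n lem.
Qed.

(** Unlike the supremum or tau, it has a countable type of values, so that one can
    condition on it value by value. *)
Definition level (w : Omega) : option int :=
  if pselect (exists m, sup_val_is v q m (xi^~ w)) is left h then Some (projT1 (cid h))
  else None.

Definition tau_value (c : option int) : K := oapp (fun m : int => rho ^ m) 0 c.

Lemma levelP w m : level w = Some m <-> sup_val_is v q m (xi^~ w).
Proof.
rewrite /level; case: pselect => [h|nh]; last by split => // H; case: nh; exists m.
case: cid => m' /= H'; split => [[<-]//|H].
by congr Some; exact: sup_val_is_inj H' H.
Qed.

Lemma tauE w : tau v rho q xi w = tau_value (level w).
Proof.
rewrite /tau; case: pselect => [h|nh].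
  by case: cid => m /= /sup_val_isP/levelP ->.
case e : (level w) => [m|]//; case: nh; exists m.
by apply/sup_val_isP/levelP.
Qed.

Lemma tau_value_inj : injective tau_value.
Proof.
move=> [m|] [n|] //=; first by move/(rhoz_inj hv hrho) => ->.
  by move/eqP; rewrite (negbTE (rhoz_neq0 hv hrho m)).
by move/esym/eqP; rewrite (negbTE (rhoz_neq0 hv hrho n)).
Qed.

Lemma measurable_path : measurable_fun setT ((fun w i => xi i w) : Omega -> M).
Proof. by apply: measurable_fun_prod_space => k; exact: measurable_funP. Qed.

Lemma measurable_path_preimage (B : set M) : measurable B ->
  measurable [set w | B (xi^~ w)].
Proof.
by move=> mB; rewrite -[X in measurable X]setTI; exact: measurable_path.
Qed.

Lemma measurable_level c : measurable (level @^-1` [set c]).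
Proof.
have mS m : measurable (level @^-1` [set Some m]).
  rewrite (_ : _ @^-1` _ = [set w | sup_val_is v q m (xi^~ w)]).
    by apply: measurable_path_preimage; exact: measurable_sup_val_is.
  by apply/funext => w; apply: propext; exact: levelP.
case: c => [m|]; first exact: mS.
rewrite (_ : _ @^-1` _ = ~` \bigcup_m (level @^-1` [set Some m])).
  apply: measurableC; apply: countable_bigcupT_measurable => //; exact: countableP.
apply/seteqP; split => w /=; first by move=> e [m _ /=]; rewrite e.
by case e : (level w) => [m|]// []; exists m.
Qed.

(** Among bounded nonzero valuations, a discrete set, there is a largest one. *)
Lemma level_None w : level w = None -> ~ unbounded v q (xi^~ w) ->
  forall i, v (xi i w) = 0.
Proof.
move=> lN nunb i; apply: contrapT => xi0.
have [N HN] : exists N : nat, forall j, v (xi j w) < radius (- N%:Z).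
  apply: contrapT => H; apply: nunb => N; apply: contrapT => H'; apply: H.
  by exists N => j; rewrite ltNge; apply/negP => xj; apply: H'; exists j.
(* Exponents are counted from the upper bound q ^ N downwards, so that the largest
   valuation has the least k. *)
pose p (k : nat) := `[< exists j, v (xi j w) = radius (k%:Z - N%:Z) >].
have pex : exists k, p k.
  have [//|[m xm]] := val_spec hv (xi i w).
  have := HN i; rewrite xm (lt_radius hv) => Nm.
  exists (absz (m + N%:Z)); apply/asboolP; exists i; rewrite xm; congr radius; lia.
case: (ex_minnP pex) => k /asboolP[j xj] kmin.
have : level w = Some (k%:Z - N%:Z).
  apply/levelP; split; last by exists j.
  move=> l; have [->|[m xm]] := val_spec hv (xi l w); first by rewrite ltW// (radius_gt0 hv).
  have := HN l; rewrite xm (lt_radius hv) (le_radius hv) => Nm.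
  have /kmin : p (absz (m + N%:Z)).
    by apply/asboolP; exists l; rewrite xm; congr radius; lia.
  lia.
by rewrite lN.
Qed.

Lemma sup_val_lty w : ~ unbounded v q (xi^~ w) -> (sup_val v xi w < +oo)%E.
Proof.
move=> nunb; have [N HN] : exists N : nat, forall j, v (xi j w) < radius (- N%:Z).
  apply: contrapT => H; apply: nunb => N; apply: contrapT => H'; apply: H.
  by exists N => j; rewrite ltNge; apply/negP => xj; apply: H'; exists j.
apply: (@le_lt_trans _ _ (radius (- N%:Z))%:E); last by rewrite ltry.
by apply: ge_ereal_sup => _ [i _ <-]; rewrite lee_fin ltW.
Qed.

End Tau.

(** * Rotatable sequences are scaled Gaussian sequences *)

Section Forward.
Context {R : realType} {K : topologicalFieldType}.
Variables (v : K -> R) (q : nat).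
Hypothesis hK : local_field v q.
Let hv : normalized_valuation v q := lf_valuation hK.
Variable rho : K.
Hypothesis hrho : v rho = q%:R^-1.
Variable lambda : {measure set (borel K) -> \bar R}.
Hypothesis hlambda : haar_measure lambda.
Hypothesis hlambda1 : lambda (ring_of_integers v) = 1%E.
Context d (Omega : measurableType d) (P : probability Omega R).
Variable xi : nat -> {RV P >-> borel K}.
Hypothesis rot : rotatable P v xi.

Local Notation radius := (@radius R q).
Local Notation gamma := (gamma v lambda).
Local Notation M := (prod_space nat (borel K)).
Local Notation level := (level v q xi).

Lemma rotatable_bounded : P [set w | unbounded v q (xi^~ w)] = 0%E.
Proof.
have [mu [muE mu1 mu_shear]] := rotatable_law hv hrho rot.
by have := unbounded_null hv hrho mu1 mu_shear; rewrite muE.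
Qed.

Lemma rotatable_sup_finite : {ae P, forall w, (sup_val v xi w < +oo)%E}.
Proof.
exists [set w | unbounded v q (xi^~ w)]; split.
- exact: (measurable_path_preimage xi (measurable_unbounded hv)).
- exact: rotatable_bounded.
- by move=> w /= nsup; apply: contrapT => /sup_val_lty.
Qed.

Lemma rotatable_level_gaussian m n (A : nat -> set (borel K)) :
  (forall i, measurable (A i)) ->
  P (level @^-1` [set Some m] `&`
     box_event (fun i w => rho ^ (- m) * (xi i w : K) : borel K) n A) =
  ((\prod_(i < n) gamma (A i)) * P (level @^-1` [set Some m]))%E.
Proof.
move=> mA; have [mu [muE mu1 mu_shear]] := rotatable_law hv hrho rot.
have := scaled_coordinates_gaussian hv hrho hlambda hlambda1 mu1 mu_shear m n mA.
have lE : level @^-1` [set Some m] = (fun w k => xi k w) @^-1` sup_val_is v q m.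
  by apply/funext => w; apply: propext; exact: levelP.
by rewrite !muE lE.
Qed.

Variable G : probability (borel K) R.
Variable zeta : nat -> borel K -> borel K.
Hypothesis mzeta : forall i, measurable_fun setT (zeta i).
Hypothesis zeta_box : forall n A, (forall i, measurable (A i)) ->
  G (box_event zeta n A) = (\prod_(i < n) gamma (A i))%E.

(** The Gaussian sequence on the extension: xi / tau where tau is nonzero, and the
    auxiliary sequence [zeta] elsewhere. *)
Definition normalized_coord (i : nat) (c : option int) (w : Omega * borel K) : borel K :=
  if c is Some m then rho ^ (- m) * (xi i w.1 : K) else zeta i w.2.

Let eta (i : nat) (w : Omega * borel K) : borel K := normalized_coord i (level w.1) w.

Lemma measurable_level_fst c :
  measurable ((level \o fst : Omega * borel K -> option int) @^-1` [set c]).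
Proof.
rewrite comp_preimage -[X in measurable X]setTI; apply: measurable_fst => //.
exact: measurable_level.
Qed.

Lemma measurable_eta i : measurable_fun setT (eta i).
Proof.
apply: (measurable_fun_classes (cl := level \o fst) measurable_level_fst (f := normalized_coord i)).
move=> [m|] /=.
  apply: (measurable_fun_borelZ hv hrho).
  by apply: measurableT_comp; [exact: measurable_funP|exact: measurable_fst].
by apply: measurableT_comp; [exact: mzeta|exact: measurable_snd].
Qed.

Variable P' : probability (Omega * borel K)%type R.
Hypothesis P'X : forall A B, measurable A -> measurable B -> P' (A `*` B) = (P A * G B)%E.

Lemma extension_fst A : measurable A -> P' (fst @^-1` A) = P A.
Proof.
move=> mA; rewrite -[RHS]mule1 -(probability_setT G) -P'X//.
by congr (P' _); apply/seteqP; split => [w ?|w []//]; split.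
Qed.

(** Given the level, eta is Gaussian: where tau is nonzero this is the main result
    on rotatable laws, and elsewhere eta is the auxiliary sequence. The conditional
    law does not depend on the level, hence the independence from tau. *)
Lemma eta_level_box c n A : (forall i, measurable (A i)) ->
  P' (box_event eta n A `&` (level \o fst) @^-1` [set c]) =
  ((\prod_(i < n) gamma (A i)) * P' ((level \o fst) @^-1` [set c]))%E.
Proof.
move=> mA; rewrite [in RHS]comp_preimage extension_fst; last exact: measurable_level.
case: c => [m|].
  rewrite -rotatable_level_gaussian// -[RHS]extension_fst; last first.
    apply: measurableI; first exact: measurable_level.
    apply: measurable_box_event => // i.
    by apply: (measurable_fun_borelZ hv hrho); exact: measurable_funP.
  congr (P' _); apply/seteqP; split => w.
    by move=> [wA /= wm]; split => // i /wA; rewrite /eta wm.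
  by move=> [wm wA]; split => // i /wA; rewrite /eta wm.
rewrite -zeta_box// muleC -P'X; [|exact: measurable_level|exact: measurable_box_event].
congr (P' _); apply/seteqP; split => w.
  by move=> [wA /= wm]; split => // i /wA; rewrite /eta wm.
by move=> [/= wm wA]; split => // i /wA; rewrite /eta wm.
Qed.

Let sigma : Omega * borel K -> borel K := tau v rho q xi \o fst.

Lemma measurable_tau_fst : measurable_fun setT sigma.
Proof.
rewrite (_ : sigma = fun w => cst (tau_value rho (level w.1) : borel K) w).
  apply: (measurable_fun_classes (cl := level \o fst) measurable_level_fst
    (f := fun c => cst (tau_value rho c : borel K))) => c.
  exact: measurable_cst.
by apply/funext => w; rewrite /sigma /= (tauE hv).
Qed.

Lemma tau_eta_box S n A : measurable S -> (forall i, measurable (A i)) ->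
  P' (sigma @^-1` S `&` box_event eta n A) =
  ((\prod_(i < n) gamma (A i)) * P' (sigma @^-1` S))%E.
Proof.
move=> mS mA.
have mbox : measurable (box_event eta n A).
  by apply: measurable_box_event => //; exact: measurable_eta.
have msS : measurable (sigma @^-1` S).
  by rewrite -[X in measurable X]setTI; exact: measurable_tau_fst.
have gfin : (\prod_(i < n) gamma (A i))%E \is a fin_num.
  by apply: prode_fin_num => i _; exact: (gamma_fin_num hv hlambda1).
have g0 : (0 <= \prod_(i < n) gamma (A i))%E.
  by apply: prode_ge0 => i _; exact: (gamma_ge0 hv hlambda1).
rewrite -(fineK gfin).
apply: (measure_classes_scale (cl := level \o fst) measurable_level_fst).
- exact: fine_ge0.
- exact: measurableI.
- exact: msS.
move=> c; rewrite fineK//.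
have sc w : level w.1 = c -> sigma w = tau_value rho c.
  by move=> <-; rewrite /sigma/= (tauE hv).
have [Sc|nSc] := pselect (S (tau_value rho c)).
  have e : sigma @^-1` S `&` (level \o fst) @^-1` [set c] = (level \o fst) @^-1` [set c].
    by apply/seteqP; split => [w []//|w wc]; split => //; rewrite /preimage/= (sc _ wc).
  by rewrite setIAC e setIC; exact: eta_level_box.
have e : sigma @^-1` S `&` (level \o fst) @^-1` [set c] = set0.
  by apply/seteqP; split => // w [+ wc]; rewrite /preimage/= (sc _ wc).
by rewrite setIAC e set0I measure0 mule0.
Qed.

Lemma eta_box n A : (forall i, measurable (A i)) ->
  P' (box_event eta n A) = (\prod_(i < n) gamma (A i))%E.
Proof.
move=> mA; have := @tau_eta_box setT n A measurableT mA.
by rewrite preimage_setT setTI => ->; rewrite -[RHS]mule1; congr (_ * _)%E;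
  exact: probability_setT.
Qed.

Lemma eta_law i : has_law P' (eta i) gamma.
Proof.
move=> A mA; rewrite /pushforward.
have := @eta_box i.+1 (fun j => if j == i then A else setT).
rewrite big_ord_recr/= eqxx big1 ?mul1e => [<-|j _].
- congr (P' _); apply/seteqP; split => w.
    by move=> wA j _; case: eqP => // ->.
  by move=> /(_ i (ltnSn i)); rewrite eqxx.
- by move=> j; case: ifP.
- by rewrite ltn_eqF ?ltn_ord// gamma_setT.
Qed.

Lemma eta_mutually_independent : mutually_independent P' eta.
Proof.
move=> J A mA.
(* A finite subfamily is a box with unconstrained coordinates outside J. *)
pose n := (\max_(i <- J) i).+1.
have Jn i : i \in J -> (i < n)%N by move=> iJ; rewrite ltnS; apply: leq_bigmax_seq.
pose B i := if i \in J then A i else setT.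
have mB i : measurable (B i) by rewrite /B; case: ifP.
rewrite (_ : \bigcap_(i in _) _ = box_event eta n B); last first.
  apply/seteqP; split => w wA i.
    by move=> ilt; rewrite /B; case: ifPn => // iJ; exact: wA.
  by move=> /= iJ; have := wA i (Jn i iJ); rewrite /B iJ.
rewrite eta_box//.
rewrite (eq_bigr (fun i : 'I_n => if (i : nat) \in J then gamma (A i) else 1%E)); last first.
  by move=> i _; rewrite /B; case: ifP => // _; exact: gamma_setT.
rewrite -(big_mkord xpredT (fun i => if i \in J then gamma (A i) else 1%E)).
rewrite -big_mkcond/= -big_filter.
rewrite (perm_big (J : seq nat)); last first.
  apply: uniq_perm; [by rewrite filter_uniq// iota_uniq|exact: fset_uniq|move=> i].
  by rewrite mem_filter mem_index_iota /=; case: (boolP (i \in J)) => //= /Jn.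
by apply: eq_bigr => i _; have := eta_law i (mA i); rewrite /pushforward => ->.
Qed.

Lemma tau_eta_independent :
  independent P' sigma ((fun w i => eta i w) : Omega * borel K -> M).
Proof.
move=> S B mS mB.
have msS : measurable (sigma @^-1` S).
  by rewrite -[X in measurable X]setTI; exact: measurable_tau_fst.
have meta : measurable_fun setT ((fun w i => eta i w) : Omega * borel K -> M).
  by apply: measurable_fun_prod_space => i; exact: measurable_eta.
have [m1 Hm1] := image_restriction_measure P' msS meta.
have [m2 Hm2] := image_restriction_measure P' measurableT meta.
have Pfin : P' (sigma @^-1` S) \is a fin_num by exact: fin_num_measure.
have c0 : 0 <= fine (P' (sigma @^-1` S)) by exact: fine_ge0.
pose m3 : {measure set M -> \bar R} := mscale (NngNum c0) m2.
have m3E C : m3 C = (P' (sigma @^-1` S) * P' ((fun w i => eta i w) @^-1` C))%E.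
  by rewrite /m3/= /mscale/= fineK// Hm2 setTI.
rewrite -m3E -Hm1; apply: sequence_measure_unique mB.
  by rewrite Hm1 preimage_setT setIT ltey_eq Pfin.
move=> n A mA; rewrite Hm1 m3E.
have e : (fun w i => eta i w) @^-1` (box_event (@coord _ (borel K)) n A) = box_event eta n A.
  by [].
rewrite e; apply: (etrans (tau_eta_box n mS mA)); rewrite muleC.
by congr (_ * _)%E; apply: esym; exact: eta_box.
Qed.

Lemma eta_representation i :
  {ae P', forall w, (xi i w.1 : K) = (sigma w : K) * (eta i w : K)}.
Proof.
exists (fst @^-1` [set w | unbounded v q (xi^~ w)]); split.
- rewrite -[X in measurable X]setTI; apply: measurable_fst => //.
  exact: (measurable_path_preimage xi (measurable_unbounded hv)).
- rewrite extension_fst; first exact: rotatable_bounded.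
  exact: (measurable_path_preimage xi (measurable_unbounded hv)).
move=> w /= nw; apply: contrapT => nunb; apply: nw.
rewrite /sigma/= (tauE hv) /eta; case e : (level w.1) => [m|]/=.
  by rewrite -invr_expz mulVKf// (rhoz_neq0 hv hrho).
by rewrite mul0r; apply/eqP; rewrite -(val_eq0 hv) (level_None hv e).
Qed.

End Forward.

(** * Scaled Gaussian sequences are rotatable *)

Section Backward.
Context {R : realType} {K : topologicalFieldType}.
Variables (v : K -> R) (q : nat).
Hypothesis hv : normalized_valuation v q.
Variable rho : K.
Hypothesis hrho : v rho = q%:R^-1.
Variable lambda : {measure set (borel K) -> \bar R}.
Hypothesis hlambda : haar_measure lambda.
Hypothesis hlambda1 : lambda (ring_of_integers v) = 1%E.
Context d (Omega : measurableType d) (P : probability Omega R).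
Variable xi : nat -> {RV P >-> borel K}.
Context d' (Omega' : measurableType d') (P' : probability Omega' R).
Variable pi : {mfun Omega' >-> Omega}.
Variable eta : nat -> {RV P' >-> borel K}.
Hypothesis ext : extension P P' pi.
Hypothesis rep : forall i : nat, {ae P', forall w,
  (xi i (pi w) : K) = (tau v rho q xi (pi w) : K) * (eta i w : K)}.
Hypothesis iid : iid_standard_gaussian P' v lambda eta.
Hypothesis ind : independent P' (tau v rho q xi \o pi)
  ((fun w i => eta i w) : Omega' -> prod_space nat (borel K)).

Local Notation radius := (@radius R q).
Local Notation gamma := (gamma v lambda).
Local Notation M := (prod_space nat (borel K)).
Local Notation level := (level v q xi).

Lemma iid_box n A : (forall i, measurable (A i)) ->
  P' (box_event eta n A) = (\prod_(i < n) gamma (A i))%E.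
Proof.
move=> mA; have [mi law] := iid.
rewrite (_ : box_event eta n A =
    \bigcap_(i in [set` [fset i | i in iota 0 n]%fset]) (eta i @^-1` A i)); last first.
  apply/seteqP; split => w wA i.
    by rewrite /= !inE /= mem_iota add0n => /andP[_]; exact: wA.
  by move=> ilt; apply: wA; rewrite /= !inE /= mem_iota.
rewrite mi// (perm_big (iota 0 n)); last first.
  apply: uniq_perm; [exact: fset_uniq|exact: iota_uniq|by move=> i; rewrite !inE].
rewrite -[in LHS](subn0 n) -/(index_iota 0 n) big_mkord.
by apply: eq_bigr => i _; have := law i _ (mA i).
Qed.

Lemma measurable_xi_preimage n (U : 'M[K]_n) C : measurable C ->
  measurable [set w | C (mul_column U (fun i => xi i w))].
Proof.
move=> mC; rewrite -[X in measurable X]setTI.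
have mX i : measurable_fun setT (xi i) by exact: measurable_funP.
exact: (measurable_mul_column hv hrho U mX measurableT mC).
Qed.

(** On a level set xi is a constant t times eta, and t commutes with U; by
    independence and by invariance of Gaussian vectors, the probability does not
    depend on U. *)
Lemma rotated_on_level n (U : 'M[K]_n) C c : GL_integers v U -> measurable C ->
  P ([set w | C (mul_column U (fun i => xi i w))] `&` level @^-1` [set c]) =
  (P' ((tau v rho q xi \o pi) @^-1` [set tau_value rho c]) *
   P' [set w | C (fun i : 'I_n => (tau_value rho c * (eta i w : K))%R)])%E.
Proof.
move=> GU mC; set t := tau_value rho c.
have mxi i : measurable_fun setT (xi i) by exact: measurable_funP.
have meta i : measurable_fun setT (eta i) by exact: measurable_funP.
have mUxi := measurable_xi_preimage U mC.
have mlev := measurable_level hv xi c.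
have mpi B : measurable B -> measurable (pi @^-1` B).
  by move=> mB; rewrite -[X in measurable X]setTI; exact: measurable_funP.
pose Ct : set (prod_space 'I_n (borel K)) := [set y | C (fun i => (t * (y i : K) : K))].
have mCt : measurable Ct.
  have mt : measurable_fun setT
      ((fun y i => (t * (y i : K) : K)) : prod_space 'I_n (borel K) -> prod_space 'I_n (borel K)).
    apply: measurable_fun_prod_space => i.
    by apply: (measurable_fun_borelZ hv hrho); exact: measurable_coord.
  by rewrite -[X in measurable X]setTI; exact: mt.
pose D : set M := [set x | Ct (mul_column U x)].
have mD : measurable D.
  rewrite -[X in measurable X]setTI.
  by apply: (measurable_mul_column hv hrho U (f := @coord _ (borel K))) => // i; exact: measurable_coord.
have mtau : (tau v rho q xi \o pi) @^-1` [set t] = pi @^-1` (level @^-1` [set c]).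
  apply/funext => w; apply: propext; rewrite /preimage/= (tauE hv).
  by split => [/(tau_value_inj hv hrho)|->].
have mE : measurable ((fun w i => eta i w : borel K) @^-1` D : set Omega').
  have mX : measurable_fun setT ((fun w i => eta i w) : Omega' -> M).
    exact: measurable_fun_prod_space.
  by rewrite -[X in measurable X]setTI; exact: mX.
rewrite -(gaussian_rotation hv hrho hlambda hlambda1 iid_box GU mCt).
rewrite -(ind (measurable_singleton hv t) mD) mtau.
rewrite -[LHS](ext (measurableI _ _ mUxi mlev)) /pushforward.
apply: measure_ae_eq.
- by apply: mpi; exact: measurableI.
- by apply: measurableI => //; exact: mpi.
have [N [mN N0 HN]] := ae_foralln rep.
exists N; split => // w nw; apply: HN => /= H; apply: nw.
have Hw (lw : level (pi w) = c) : (fun i => xi i (pi w) : K) = fun i => t * (eta i w : K).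
  by apply/funext => i; rewrite H (tauE hv) lw.
have eq (lw : level (pi w) = c) :
    C (mul_column U (fun i => xi i (pi w))) <-> D (fun i => eta i w).
  by rewrite (Hw lw) mul_column_scale.
split => [[Cw lw]|[lw Dw]]; first by split; [exact: lw|exact: (eq lw).1 Cw].
by split; [exact: (eq lw).2 Dw|exact: lw].
Qed.

Lemma gaussian_rotatable : rotatable P v xi.
Proof.
move=> n _ U GU C mC; rewrite /pushforward.
have GL1 : GL_integers v (1%:M : 'M[K]_n).
  split; last by rewrite det1 (val1 hv).
  by move=> i j; rewrite mxE /ring_of_integers/=; case: eqP => _; rewrite ?(val1 hv) ?(val0 hv).
have e1 : (fun (w : Omega) (i : 'I_n) => xi i w) @^-1` C =
    [set w | C (mul_column 1%:M (fun i => xi i w))].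
  by apply/funext => w /=; rewrite mul_column1.
rewrite e1 -[RHS]mul1e.
apply: (measure_classes_scale (cl := level) (measurable_level hv xi)) => //.
- exact: measurable_xi_preimage.
- exact: measurable_xi_preimage.
move=> c; rewrite mul1e.
apply: etrans (rotated_on_level c GU mC) _.
exact: esym (rotated_on_level c GL1 mC).
Qed.

End Backward.

(** * The characterization *)

Theorem theorem3p3 (R : realType) (K : topologicalFieldType)
    (v : K -> R) (q : nat) (hK : local_field v q)
    (rho : K) (hrho : v rho = q%:R^-1)
    (lambda : {measure set (borel K) -> \bar R})
    (hlambda : haar_measure lambda)
    (hlambda1 : lambda (ring_of_integers v) = 1%E)
    (d : measure_display) (Omega : measurableType d) (P : probability Omega R)
    (xi : nat -> {RV P >-> borel K}) :
  rotatable P v xi <->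
  {ae P, forall w, (sup_val v xi w < +oo)%E} /\
  exists (d' : measure_display) (Omega' : measurableType d')
    (P' : probability Omega' R) (pi : {mfun Omega' >-> Omega})
    (eta : nat -> {RV P' >-> borel K}),
    [/\ extension P P' pi,
        forall i : nat, {ae P', forall w,
          (xi i (pi w) : K) = (tau v rho q xi (pi w) : K) * (eta i w : K)},
        iid_standard_gaussian P' v lambda eta &
        independent P' (tau v rho q xi \o pi)
          ((fun w i => eta i w) : Omega' -> prod_space nat (borel K))].
Proof.
have hv := lf_valuation hK.
split => [rot|[_ repr]]; last first.
  have [d1 [W [P1 [pi [eta [ext rep iid ind]]]]]] := repr.
  exact: (gaussian_rotatable hv hrho hlambda hlambda1 ext rep iid ind).
split; first exact: (rotatable_sup_finite hK hrho rot).
have [G [zeta [mzeta zeta_box]]] := gaussian_sequence hK hrho hlambda hlambda1.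
have mX A B : measurable A -> measurable B -> (P \x G)%E (A `*` B) = (P A * G B)%E.
  by move=> mA mB; rewrite product_measure1E.
have PG1 : (P \x G)%E setT = 1%E.
  by rewrite -setXTT mX//; rewrite !probability_setT mule1.
pose P' : probability (Omega * borel K)%type R :=
  HB.pack (P \x G)%E (Measure_isProbability.Build _ _ _ (P \x G)%E PG1).
pose pi : {mfun (Omega * borel K)%type >-> Omega} :=
  HB.pack (fst : Omega * borel K -> Omega)
    (isMeasurableFun.Build _ _ _ _ (fst : Omega * borel K -> Omega) measurable_fst).
have meta := measurable_eta hK hrho xi mzeta.
pose eta i : {RV P' >-> borel K} :=
  HB.pack (fun w : Omega * borel K => normalized_coord rho xi zeta i (level v q xi w.1) w)
    (isMeasurableFun.Build _ _ _ _ _ (meta i)).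
exists _, (Omega * borel K)%type, P', pi, eta; split.
- by move=> A mA; exact: (extension_fst (P' := P') mX).
- by move=> i; exact: (eta_representation hK hrho rot zeta (P' := P') mX i).
- split.
    exact: (eta_mutually_independent hK hrho hlambda hlambda1 rot mzeta zeta_box (P' := P') mX).
  by move=> i; exact: (eta_law hK hrho hlambda hlambda1 rot mzeta zeta_box (P' := P') mX).
- exact: (tau_eta_independent hK hrho hlambda hlambda1 rot mzeta zeta_box (P' := P') mX).
Qed.
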